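(* Let $A$ be a Hopf algebra, $L\subseteq A^\circ$ a Hopf subalgebra such that $$B:=\{b\in A\mid b_{(1)}\langle l,b_{(2)}\rangle=\varepsilon(l)b \text{ for all } l\in L\}$$ is a quantum homogeneous $A$-space, $T\subseteq B^\circ$ a finite-dimensional tangent space with associated left $A$-covariant first-order differential calculus $\Omega^1(B)\in{}^A_B\mathrm{mod}_0$ and cotangent space $V^1$, and let $\sigma$ be the bimodule map of a left $A$-covariant bimodule connection $\nabla:\Omega^1(B)\to\Omega^1(B)\otimes_B\Omega^1(B)$, with dual map $\check\sigma:T\otimes T\to T\otimes T$. Let $E\in A^\circ$ satisfy $\Delta(E)=E\otimes K_1+K_2\otimes E$ for two grouplike elements $K_1,K_2\in L$, and assume that $\rho_B(E)\in T$. Then for any $l\in L$, and any $Y\in T$ such that $Y=\rho_B(W)$ for some $W\in A^\circ$, it holds that $$\check\sigma\big(\rho_B(lE)\otimes Y\big)=l_{(1)}K_2K_1^{-1}S(l_{(3)})Y\otimes\rho_B(l_{(2)}E).$$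
   Context: All algebras are unital over $\mathbb{C}$, Hopf algebras have bijective antipode $S$, Sweedler notation is used. $A^\circ$ is the dual Hopf algebra of $A$, with pairing $\langle\cdot,\cdot\rangle$; $B^\circ$ is the dual coalgebra of $B$; $\rho_B:A^\circ\to B^\circ$ is restriction to $B$. A left coideal subalgebra $B\subseteq A$ is a quantum homogeneous $A$-space if $A$ is faithfully flat as a right $B$-module and $B^+A=AB^+$, $B^+=\ker(\varepsilon|_B)$; put $\pi_B(A)=A/B^+A$. $L$ acts on the left on $B^\circ$ by $(lf)(b)=\langle l,b_{(1)}\rangle f(b_{(2)})$; thus $l\rho_B(X)=\rho_B(lX)=\rho_B(l_{(1)}XS(l_{(2)}))$ for $X\in A^\circ$, so this is the adjoint action of $L$. A tangent space is a subspace $T\subseteq B^\circ$ such that $T\oplus\mathbb{C}1$ is a right coideal of $B^\circ$ and $T$ is stable under this $L$-action. Its cotangent space is $V^1=B^+/I$, where $I=\{x\in B^+\mid X(x)=0\ \forall X\in T\}$; $T$ and $V^1$ are in non-degenerate duality. The associated left $A$-covariant first-order differential calculus is $\Omega^1(B)=A\,\square_{\pi_B}V^1$ with $\mathrm{d}b=\sum_i b_{(1)}\langle X_i,b_{(2)}\rangle\otimes e_i$, for $\{X_i\}$ a basis of $T$ and $\{e_i\}$ the dual basis of $V^1$. ${}^A_B\mathrm{mod}_0$ denotes relative Hopf modules $\mathcal F$ (finitely generated left $B$-modules with left $A$-coaction $\Delta_L$, $\Delta_L(bf)=\Delta(b)\Delta_L(f)$) with right $B$-module structure $fb=f_{(-2)}bS(f_{(-1)})f_{(0)}$.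 Put $\Phi(\mathcal F)=\mathcal F/B^+\mathcal F$; we identify $\Phi(\mathcal F\otimes_B\mathcal G)$ with $\Phi(\mathcal F)\otimes\Phi(\mathcal G)$ via $[f\otimes g]\leftrightarrow[f]\otimes[g]$, and $\Phi(\Omega^1(B))$ with $V^1$ via $[\mathrm{d}b]\leftrightarrow[b-\varepsilon(b)1]$. A connection is a linear map $\nabla:\Omega^1(B)\to\Omega^1(B)\otimes_B\Omega^1(B)$ with $\nabla(b\omega)=\mathrm{d}b\otimes\omega+b\nabla(\omega)$; it is left $A$-covariant if it is a left $A$-comodule map, and a bimodule connection if there is a (unique) $B$-bimodule endomorphism $\sigma$ of $\Omega^1(B)\otimes_B\Omega^1(B)$, its bimodule map, with $\nabla(\omega b)=\nabla(\omega)b+\sigma(\omega\otimes\mathrm{d}b)$. We also write $\sigma$ for $\Phi(\sigma):V^1\otimes V^1\to V^1\otimes V^1$. The map $\check\sigma$ is defined by $\langle\check\sigma(X\otimes Y),v\otimes w\rangle=\langle X\otimes Y,\sigma(v\otimes w)\rangle$ for $X,Y\in T$, $v,w\in V^1$, where $\langle X\otimes Y,[b]\otimes[c]\rangle=\langle X,b\rangle\langle Y,c\rangle$. *)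

(* Defs.v *)
From HB Require Import structures.
From mathcomp Require Import all_boot all_order all_algebra.
From mathcomp Require Import generic_quotient ring_quotient.
From mathcomp Require Import boolp classical_sets functions reals complex.
From mathcomp Require Import xfinmap monalg.

Set Implicit Arguments.
Unset Strict Implicit.
Unset Printing Implicit Defensive.

Import GRing.Theory.
Local Open Scope ring_scope.
Local Open Scope quotient_scope.

Section SubSpace.
Variables (K : fieldType) (V : lmodType K).

Record sub_of (U : submodClosed V) : Type :=
  SubOf { sub_val : V; _ : sub_val \in U }.

HB.instance Definition _ U := [isSub for @sub_val U].
HB.instance Definition _ U := [Choice of sub_of U by <:].
HB.instance Definition _ U := [SubChoice_isSubLmodule of sub_of U by <:].

Definition span (S : V -> Prop) : {pred V} := [pred x | `[<
  exists (n : nat) (c : 'I_n -> K) (v : 'I_n -> V),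
    (forall i, S (v i)) /\ x = \sum_i c i *: v i >]].

Variable S : V -> Prop.

Lemma span_gen x : S x -> x \in span S.
Proof.
move=> Sx; apply/asboolP; exists 1%N, (fun=> 1), (fun=> x).
by split=> //; rewrite big_ord1 scale1r.
Qed.

Lemma span_submod_closed : submod_closed (span S).
Proof.
split=> [|a x y].
  apply/asboolP; exists 0%N, (fun=> 0), (fun=> 0).
  by split=> [[]|] //; rewrite big_ord0.
move=> /asboolP[n [c [v [Sv ->]]]] /asboolP[m [d [w [Sw ->]]]].
apply/asboolP; exists (n + m)%N.
exists (fun i => match fintype.split i with inl j => a * c j | inr j => d j end).
exists (fun i => match fintype.split i with inl j => v j | inr j => w j end).
split=> [i|]; first by case: (fintype.split i).
rewrite big_split_ord /= scaler_sumr; congr (_ + _); apply: eq_bigr => i _.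
  case: (splitP (lshift m i)) => j /= ij; first by rewrite scalerA; congr (_ * c _ *: v _); exact: val_inj.
  by have := ltn_ord i; rewrite ij ltnNge leq_addr.
case: (splitP (rshift n i)) => j /= ij.
  by have := ltn_ord j; rewrite -ij ltnNge leq_addr.
by move/addnI: ij => ij; congr (d _ *: w _); exact: val_inj.
Qed.

HB.instance Definition _ :=
  GRing.isSubmodClosed.Build K V (span S) span_submod_closed.

(* The quotient of [V] by the subspace spanned by [S]. *)
Definition quot : Type := Quotient.quot (span S).

HB.instance Definition _ := GRing.Zmodule.on quot.

Definition proj (x : V) : quot := \pi_(Quotient.quot (span S)) x.
Definition qrepr (q : quot) : V := repr (q : Quotient.quot (span S)).

Lemma qreprK : cancel qrepr proj.
Proof. by move=> q; exact: reprK. Qed.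

Lemma proj_eq x y : proj x = proj y <-> x - y \in span S.
Proof.
rewrite -Quotient.equivE; split=> [/eqP|h]; first by rewrite piE.
by apply/eqP; rewrite piE.
Qed.

Lemma projB : {morph proj : x y / x - y}.
Proof. by move=> x y; rewrite /proj piE. Qed.

Definition quot_scale (a : K) (q : quot) : quot := proj (a *: qrepr q).

Lemma quot_scaleE a x : quot_scale a (proj x) = proj (a *: x).
Proof.
apply/proj_eq; rewrite -scalerBr rpredZ//.
by apply/proj_eq; rewrite qreprK.
Qed.

HB.instance Definition _ := GRing.isZmodMorphism.Build V quot proj projB.

Fact quot_scaleA a b q : quot_scale a (quot_scale b q) = quot_scale (a * b) q.
Proof. by rewrite -[q]qreprK !quot_scaleE scalerA. Qed.
Fact quot_scale1 : left_id 1 quot_scale.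
Proof. by move=> q; rewrite -[q]qreprK quot_scaleE scale1r. Qed.
Fact quot_scaleDr : right_distributive quot_scale +%R.
Proof.
by move=> a p q; rewrite -[p]qreprK -[q]qreprK -raddfD !quot_scaleE scalerDr raddfD.
Qed.
Fact quot_scaleDl q : {morph quot_scale^~ q : a b / a + b}.
Proof. by move=> a b; rewrite -[q]qreprK !quot_scaleE scalerDl raddfD. Qed.

HB.instance Definition _ := GRing.Zmodule_isLmodule.Build K quot
  quot_scaleA quot_scale1 quot_scaleDr quot_scaleDl.

Lemma projZ : scalable proj.
Proof. by move=> a x; rewrite -quot_scaleE. Qed.

HB.instance Definition _ := GRing.isScalable.Build K V quot *:%R proj projZ.

End SubSpace.

Section Equalizer.
Variables (K : fieldType) (V W : lmodType K) (f g : {linear V -> W}).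

Definition equalizer : {pred V} := [pred v | f v == g v].

Fact equalizer_submod_closed : submod_closed equalizer.
Proof.
split=> [|a x y]; rewrite !inE ?linear0// => /eqP xE /eqP yE.
by rewrite !linearP xE yE.
Qed.

HB.instance Definition _ :=
  GRing.isSubmodClosed.Build K V equalizer equalizer_submod_closed.

End Equalizer.

Section SubAlgebra.
Variables (K : fieldType) (A : algType K) (B : subalgClosed A).

Record subalg_of : Type := SubalgOf { subalg_val : A; _ : subalg_val \in B }.

HB.instance Definition _ := [isSub for subalg_val].
HB.instance Definition _ := [Choice of subalg_of by <:].
HB.instance Definition _ := [SubChoice_isSubAlgebra of subalg_of by <:].

End SubAlgebra.

Section Tensor.
Variables (K : fieldType) (V W : lmodType K).

Local Notation free := {malg K[(V * W)%type]}.

Definition tensor_rel (t : free) : Prop :=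
  (exists a v v' w, t = << (a *: v + v', w) >>
                        - (a *: << (v, w) >> + << (v', w) >>)) \/
  (exists a v w w', t = << (v, a *: w + w') >>
                        - (a *: << (v, w) >> + << (v, w') >>)).

Definition tensor : lmodType K := quot tensor_rel.

Definition bilinear2 (P : lmodType K) (f : V -> W -> P) : Prop :=
  (forall w, linear (f^~ w)) /\ (forall v, linear (f v)).

Definition free_lift (P : lmodType K) (f : V -> W -> P) (g : free) : P :=
  \sum_(p <- msupp g) g@_p *: f p.1 p.2.

End Tensor.

HB.lock Definition pure (K : fieldType) (V W : lmodType K) (v : V) (w : W) :
  tensor V W := proj (@tensor_rel K V W) << (v, w) >>.

(* The sum of [f] over a chosen representative of [t]: the linear map induced by
   [f] as soon as [f] is bilinear (see [tliftE] and [tlift_linear]). *)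
HB.lock Definition tlift (K : fieldType) (V W P : lmodType K) (f : V -> W -> P)
  (t : tensor V W) : P := free_lift f (qrepr t).

Section TensorTheory.
Variables (K : fieldType) (V W : lmodType K).

Local Notation free := {malg K[(V * W)%type]}.
Local Notation tensor := (tensor V W).
Local Notation tensor_rel := (@tensor_rel K V W).

Lemma pure_bilinear : bilinear2 (@pure K V W).
Proof.
split=> [w a v v'|v a w w']; rewrite pure.unlock -linearP; apply/proj_eq/span_gen.
  by left; exists a, v, v', w.
by right; exists a, v, w, w'.
Qed.

Section Lift.
Variables (P : lmodType K) (f : V -> W -> P).

Lemma free_liftEw (D : {fset (V * W)%type}) (g : free) : (msupp g `<=` D)%fset ->
  free_lift f g = \sum_(p <- D) g@_p *: f p.1 p.2.
Proof.
move=> sD; rewrite /free_lift (big_fset_incl _ sD)// => p _ /mcoeff_outdom ->.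
by rewrite scale0r.
Qed.

Lemma free_lift_linear : linear (free_lift f).
Proof.
move=> a g h; pose D := (msupp g `|` msupp h `|` msupp (a *: g + h))%fset.
have gD : (msupp g `<=` D)%fset by rewrite /D -fsetUA fsubsetUl.
have hD : (msupp h `<=` D)%fset by rewrite /D fsetUAC fsubsetUr.
rewrite (free_liftEw gD) (free_liftEw hD) (@free_liftEw D) ?fsubsetUr//.
rewrite scaler_sumr -big_split/=; apply: eq_bigr => p _.
by rewrite mcoeffD mcoeffZ scalerDl scalerA.
Qed.

HB.instance Definition _ :=
  GRing.isLinear.Build K free P *:%R (free_lift f) free_lift_linear.

Lemma free_liftU v w : free_lift f << (v, w) >> = f v w.
Proof.
rewrite (@free_liftEw [fset (v, w)]%fset) ?msuppU_le//.
by rewrite big_seq_fset1 mcoeffUU scale1r.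
Qed.

Hypothesis fB : bilinear2 f.

Lemma free_lift_span t : t \in span tensor_rel -> free_lift f t = 0.
Proof.
move=> /asboolP[n [c [v [Sv ->]]]]; rewrite linear_sum big1// => i _.
rewrite linearZ/=; suff -> : free_lift f (v i) = 0 by rewrite scaler0.
case: (Sv i) => -[a [x [y [z ->]]]];
  rewrite linearB linearP /= !free_liftU ?(fB.1 z) ?(fB.2 x) subrr//.
Qed.

Lemma tlift_proj t : tlift f (proj _ t) = free_lift f t.
Proof.
rewrite tlift.unlock; apply/eqP; rewrite -subr_eq0 -linearB.
apply/eqP/free_lift_span.
by apply/proj_eq; rewrite qreprK.
Qed.

Lemma tliftE v w : tlift f (pure v w) = f v w.
Proof. by rewrite pure.unlock tlift_proj free_liftU. Qed.

Lemma tlift_linear : linear (tlift f).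
Proof.
by move=> a s t; rewrite -[s]qreprK -[t]qreprK -linearP !tlift_proj linearP.
Qed.

Lemma tlift_sum n (v : 'I_n -> V) (w : 'I_n -> W) :
  tlift f (\sum_i pure (v i) (w i)) = \sum_i f (v i) (w i).
Proof.
pose L : {linear tensor -> P} :=
  HB.pack (tlift f) (GRing.isLinear.Build K _ _ _ _ tlift_linear).
transitivity (L (\sum_i pure (v i) (w i))) => //.
by rewrite linear_sum; apply: eq_bigr => i _; exact: tliftE.
Qed.

End Lift.

Lemma tensor_sum (t : tensor) : exists n (v : 'I_n -> V) (w : 'I_n -> W),
  t = \sum_i pure (v i) (w i).
Proof.
rewrite -[t]qreprK [qrepr t]monalgE; set s := enum_fset _.
pose p i := tnth (in_tuple s) i.
exists (size s), (fun i => (qrepr t)@_(p i) *: (p i).1), (fun i => (p i).2).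
rewrite linear_sum big_tnth; apply: eq_bigr => i _; rewrite -/(p i).
have -> : << (qrepr t)@_(p i) *g p i >> = (qrepr t)@_(p i) *: << p i >>.
  by apply/malgP=> k; rewrite mcoeffZ !mcoeffU mulr_natr.
have [+ _] := pure_bilinear => /(_ (p i).2) lin1.
have pure0 : pure (0 : V) (p i).2 = 0 :> tensor.
  by have /= := lin1 (-1) 0 0; rewrite scaler0 addr0 scaleN1r addNr.
have /= := lin1 (qrepr t)@_(p i) (p i).1 0; rewrite addr0 pure0 addr0 => ->.
by rewrite linearZ pure.unlock; case: (p i).
Qed.

End TensorTheory.

Notation "v ⊗ w" := (pure v w) (at level 40, left associativity) : ring_scope.

Section TensorMap.
Variables (K : fieldType).

Definition tmap (V V' W W' : lmodType K) (f : V -> V') (g : W -> W')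
    : tensor V W -> tensor V' W' :=
  tlift (fun v w => f v ⊗ g w).

Lemma tmap_bilinear (V V' W W' : lmodType K)
    (f : {linear V -> V'}) (g : {linear W -> W'}) :
  bilinear2 (fun v w => f v ⊗ g w).
Proof.
split=> [w|v] a x y /=; rewrite linearP.
  by rewrite (pure_bilinear _ _).1.
by rewrite (pure_bilinear _ _).2.
Qed.

Lemma tmap_linear (V V' W W' : lmodType K)
    (f : {linear V -> V'}) (g : {linear W -> W'}) : linear (tmap f g).
Proof. exact/tlift_linear/tmap_bilinear. Qed.

HB.instance Definition _ (V V' W W' : lmodType K)
    (f : {linear V -> V'}) (g : {linear W -> W'}) :=
  GRing.isLinear.Build K (tensor V W) (tensor V' W') *:%R (tmap f g)
    (tmap_linear f g).

Variables U V W : lmodType K.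

Definition tassoc : tensor (tensor U V) W -> tensor U (tensor V W) :=
  tlift (fun t w => tlift (fun u v => u ⊗ (v ⊗ w)) t).

Lemma tassoc_bilinear_in (w : W) : bilinear2 (fun (u : U) (v : V) => u ⊗ (v ⊗ w)).
Proof.
split=> [v|u] a x y /=; first by rewrite (pure_bilinear _ _).1.
by rewrite (pure_bilinear _ _).1 (pure_bilinear _ _).2.
Qed.

Lemma tassoc_bilinear :
  bilinear2 (fun (t : tensor U V) (w : W) =>
    tlift (fun u v => u ⊗ (v ⊗ w)) t).
Proof.
split=> [w|t a x y]; first exact/tlift_linear/tassoc_bilinear_in.
have [n [u [v ->]]] := tensor_sum t.
have E z := tlift_sum (tassoc_bilinear_in z) u v.
rewrite /= (E x) (E y) (E (a *: x + y)).
rewrite scaler_sumr -big_split/=; apply: eq_bigr => i _.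
by rewrite (pure_bilinear _ _).2 (pure_bilinear _ _).2.
Qed.

Lemma tassocE u v w : tassoc ((u ⊗ v) ⊗ w) = u ⊗ (v ⊗ w).
Proof.
rewrite /tassoc tliftE ?tliftE//; first exact: tassoc_bilinear_in.
exact: tassoc_bilinear.
Qed.

HB.instance Definition _ :=
  GRing.isLinear.Build K (tensor (tensor U V) W) (tensor U (tensor V W)) *:%R
    tassoc (tlift_linear tassoc_bilinear).

End TensorMap.

Record hopfAlg (K : fieldType) := HopfAlg {
  hopf_sort :> algType K;
  hdelta : {linear hopf_sort -> tensor hopf_sort hopf_sort};
  heps : {linear hopf_sort -> K^o};
  hS : {linear hopf_sort -> hopf_sort};
  hdelta_coassoc : forall a,
    tassoc (tmap hdelta idfun (hdelta a)) = tmap idfun hdelta (hdelta a);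
  heps_counitl : forall a, tlift (fun x y => (heps x : K) *: y) (hdelta a) = a;
  heps_counitr : forall a, tlift (fun x y => (heps y : K) *: x) (hdelta a) = a;
  hdelta1 : hdelta 1 = 1 ⊗ 1;
  hdeltaM : forall a b, hdelta (a * b) =
    tlift (fun x y => tlift (fun z t => (x * z) ⊗ (y * t)) (hdelta b)) (hdelta a);
  heps1 : heps 1 = 1;
  hepsM : forall a b, heps (a * b) = heps a * heps b;
  hS_left : forall a, tlift (fun x y => hS x * y) (hdelta a) = heps a *: 1;
  hS_right : forall a, tlift (fun x y => x * hS y) (hdelta a) = heps a *: 1;
  hS_bij : bijective hS
}.

Section Functionals.
Variable K : fieldType.

(* The coproduct of the dual is the transpose of the multiplication: [coprod2]
   says that Δ(f) = Σ_i f1_i ⊗ f2_i, and [coprod3] is its iterate, i.e. a choice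
   of Sweedler components f_(1) ⊗ f_(2) ⊗ f_(3). *)
Definition coprod2 (A : algType K) (f : A -> K^o) n (f1 f2 : 'I_n -> A -> K^o) :=
  forall a b, f (a * b) = \sum_i f1 i a * f2 i b.

Definition coprod3 (A : algType K) (f : A -> K^o) n
    (f1 f2 f3 : 'I_n -> A -> K^o) :=
  forall a b c, f (a * b * c) = \sum_i f1 i a * f2 i b * f3 i c.

(* A° : the functionals whose image under the transpose of the multiplication
   lies in A^* ⊗ A^*. *)
Definition fdual (A : algType K) (f : A -> K^o) : Prop :=
  linear f /\ exists n (f1 f2 : 'I_n -> A -> K^o),
    (forall i, linear (f1 i) /\ linear (f2 i)) /\ coprod2 f f1 f2.

Variable A : hopfAlg K.
Implicit Types f g : A -> K^o.

Definition conv f g : A -> K^o :=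
  fun a => tlift (fun x y => f x * g y : K^o) (hdelta A a).

Definition dualS f : A -> K^o := fun a => f (hS A a).

Definition conv_inverse f g : Prop :=
  [/\ fdual g, conv f g = heps A & conv g f = heps A].

Definition grouplike f : Prop :=
  [/\ fdual f, f 1 = 1 & forall a b, f (a * b) = f a * f b].

Definition hopf_subalgebra (L : submodClosed (A -> K^o)) : Prop :=
  [/\ (forall l, l \in L -> fdual l),
      (heps A : A -> K^o) \in L,
      (forall l m, l \in L -> m \in L -> conv l m \in L),
      (forall l, l \in L -> dualS l \in L) &
      (forall l, l \in L -> exists n (l1 l2 : 'I_n -> A -> K^o),
         (forall i, l1 i \in L /\ l2 i \in L) /\ coprod2 l l1 l2)].

Definition invariants (L : submodClosed (A -> K^o)) (a : A) : Prop :=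
  forall l, l \in L -> tlift (fun x y => (l y : K) *: x) (hdelta A a) = (l 1 : K) *: a.

End Functionals.

Section Modules.
Variables (K : fieldType) (B : algType K).

Definition is_action (M : lmodType K) (act : B -> M -> M) : Prop :=
  [/\ bilinear2 act, (forall m, act 1 m = m) &
      forall b c m, act (b * c) m = act b (act c m)].

Record leftModule := LeftModule {
  lm_sort :> lmodType K;
  lm_act : B -> lm_sort -> lm_sort;
  lm_actP : is_action lm_act
}.

Section Balanced.
Variables (M N : lmodType K) (ra : M -> B -> M) (la : B -> N -> N).

Definition balanced_rel (t : tensor M N) : Prop :=
  exists m b n, t = ra m b ⊗ n - m ⊗ la b n.

Definition btensor : lmodType K := quot balanced_rel.

Definition bpure (m : M) (n : N) : btensor := proj balanced_rel (m ⊗ n).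

Definition blift (P : lmodType K) (f : M -> N -> P) (t : btensor) : P :=
  tlift f (qrepr t).

Lemma bliftE (P : lmodType K) (f : M -> N -> P) : bilinear2 f ->
  (forall m b n, f (ra m b) n = f m (la b n)) ->
  forall m n, blift f (bpure m n) = f m n.
Proof.
move=> fB fb m n; pose L : {linear tensor M N -> P} :=
  HB.pack (tlift f) (GRing.isLinear.Build K _ _ _ _ (tlift_linear fB)).
rewrite -(tliftE fB) /blift; change (L (qrepr (bpure m n)) = L (m ⊗ n)).
apply/eqP; rewrite -subr_eq0 -linearB; apply/eqP.
have : qrepr (bpure m n) - m ⊗ n \in span balanced_rel.
  by apply/proj_eq; rewrite qreprK.
move=> /asboolP[k [c [v [Sv ->]]]]; rewrite linear_sum big1// => i _.
rewrite linearZ; have [x [b [y ->]]] := Sv i.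
by rewrite linearB/= !tliftE// fb subrr scaler0.
Qed.

End Balanced.

Definition exact_seq (X Y Z : Type) (z : Z) (f : X -> Y) (g : Y -> Z) : Prop :=
  forall y, g y = z <-> exists x, f x = y.

Definition faithfully_flat (M : lmodType K) (ra : M -> B -> M) : Prop :=
  forall (N1 N2 N3 : leftModule) (f : {linear N1 -> N2}) (g : {linear N2 -> N3}),
    (forall b n, f (lm_act b n) = lm_act b (f n)) ->
    (forall b n, g (lm_act b n) = lm_act b (g n)) ->
    let M_ (N N' : leftModule) (h : N -> N') :
        btensor ra (@lm_act N) -> btensor ra (@lm_act N') :=
      blift (fun m n => bpure ra (@lm_act N') m (h n)) in
    exact_seq 0 f g <-> exact_seq 0 (M_ N1 N2 f) (M_ N2 N3 g).

End Modules.

(* The [x] with [f x = y]; only used for maps [f] that are injective. *)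
Definition preimage_of (X : zmodType) (Y : Type) (f : X -> Y) (y : Y) : X :=
  xget 0 [set x | f x = y]%classic.

Section QuantumHomogeneous.
Variables (K : fieldType) (A : hopfAlg K) (B : subalgClosed A).

Local Notation Bt := (subalg_of B).
Local Notation val := (@subalg_val K A B).

Definition left_coideal : Prop :=
  forall b : Bt, exists t : tensor A Bt, tmap idfun val t = hdelta A (val b).

(* The coproduct of [b] as an element of A ⊗ B. *)
Definition hdeltaB (b : Bt) : tensor A Bt :=
  preimage_of (tmap idfun val) (hdelta A (val b)).

Definition rho (f : A -> K^o) : Bt -> K^o := f \o val.

Definition epsB : Bt -> K^o := rho (heps A).

Definition augB : {pred Bt} := [pred b | epsB b == 0].

Fact augB_submod_closed : submod_closed augB.
Proof.
rewrite /augB /epsB /rho; split=> [|a x y]; rewrite !inE/= ?linear0//.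
by move=> /eqP x0 /eqP y0; rewrite linearP x0 y0 scaler0 addr0.
Qed.

HB.instance Definition _ :=
  GRing.isSubmodClosed.Build K Bt augB augB_submod_closed.

Definition BpA (x : A) : Prop := exists b a, b \in augB /\ x = val b * a.
Definition ABp (x : A) : Prop := exists b a, b \in augB /\ x = a * val b.

Definition piB : lmodType K := quot BpA.

Definition quantum_homogeneous : Prop :=
  [/\ left_coideal,
      @faithfully_flat K Bt A (fun a b => a * val b) &
      span BpA =i span ABp].

(* Left [B]-module with a left [A]-coaction, without the axioms; these are
   collected in [mod0]. *)
Record relHopf := RelHopf {
  rh_sort :> lmodType K;
  rh_act : Bt -> rh_sort -> rh_sort;
  rh_coact : rh_sort -> tensor A rh_sort
}.

(* f b = f_(-2) b S(f_(-1)) f_(0), where f_(-2) b S(f_(-1)) ⊗ f_(0) ∈ B ⊗ F. *)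
Definition rh_ract (F : relHopf) (f : F) (b : Bt) : F :=
  tlift (@rh_act F)
    (preimage_of (tmap val idfun)
      (tmap (fun a => tlift (fun x y => x * val b * hS A y) (hdelta A a)) idfun
        (rh_coact f))).

Definition mod0 (F : relHopf) : Prop :=
  [/\ is_action (@rh_act F),
      (exists n (g : 'I_n -> F), forall f : F, exists c : 'I_n -> Bt,
         f = \sum_i rh_act (c i) (g i)),
      linear (@rh_coact F),
      (forall f : F,
         tlift (fun a g => (heps A a : K) *: g) (rh_coact f) = f /\
         tassoc (tmap (hdelta A) idfun (rh_coact f)) =
           tmap idfun (@rh_coact F) (rh_coact f)) &
      (forall b (f : F), rh_coact (rh_act b f) =
         tlift (fun x c => tlift (fun y g => (x * y) ⊗ rh_act c g) (rh_coact f))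
           (hdeltaB b))].

Definition rh_tensor (F G : relHopf) : relHopf :=
  let FG := btensor (@rh_ract F) (@rh_act G) in
  let p := bpure (@rh_ract F) (@rh_act G) in
  @RelHopf FG
    (fun b => blift (fun f g => p (rh_act b f) g))
    (blift (fun f g => tlift (fun x f0 => tlift (fun y g0 =>
       (x * y) ⊗ p f0 g0) (rh_coact g)) (rh_coact f))).

Definition rh_pure (F G : relHopf) (f : F) (g : G) : rh_tensor F G :=
  bpure (@rh_ract F) (@rh_act G) f g.

Definition BpF (F : relHopf) (x : F) : Prop :=
  exists b f, b \in augB /\ x = rh_act b f.

Definition Phi (F : relHopf) : lmodType K := quot (@BpF F).

Definition Phi_class (F : relHopf) (f : F) : Phi F := proj (@BpF F) f.

Definition Phi_map (F G : relHopf) (h : F -> G) (x : Phi F) : Phi G :=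
  Phi_class (h (qrepr x)).

End QuantumHomogeneous.

Section Calculus.
Variables (K : fieldType) (A : hopfAlg K) (B : subalgClosed A).

Local Notation Bt := (subalg_of B).
Local Notation val := (@subalg_val K A B).

Definition lact (l : A -> K^o) (f : Bt -> K^o) : Bt -> K^o :=
  fun b => tlift (fun x c => l x * f c : K^o) (hdeltaB b).

(* The sum of T and the line of 1: the unit of B° is the counit of B. *)
Definition plus1 (T : submodClosed (Bt -> K^o)) (f : Bt -> K^o) : Prop :=
  exists2 X, X \in T & exists c : K, f = X + c *: (@epsB _ _ B : Bt -> K^o).

Definition tangent_space (L : submodClosed (A -> K^o))
    (T : submodClosed (Bt -> K^o)) : Prop :=
  [/\ (forall X, X \in T -> fdual X),
      (@epsB _ _ B : Bt -> K^o) \notin T,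
      (forall f, plus1 T f -> exists n (f1 f2 : 'I_n -> Bt -> K^o),
         (forall i, plus1 T (f1 i) /\ fdual (f2 i)) /\ coprod2 f f1 f2) &
      (forall l X, l \in L -> X \in T -> lact l X \in T)].

Variable T : submodClosed (Bt -> K^o).

(* The subspace I of B^+; V^1 = B^+ / I. *)
Definition annT (x : sub_of (@augB K A B)) : Prop :=
  forall X, X \in T -> X (\val x) = 0.

Definition V1 : lmodType K := quot annT.

Definition pairT (X : sub_of T) (v : V1) : K := (\val X) (\val (qrepr v)).

(* The class of b - ε(b)1, which lies in B^+. *)
Definition V1_class (b : Bt) : V1 :=
  proj annT (insubd 0 (b - (epsB b : K) *: 1)).

(* The coaction [b] ↦ π_B(b_(1)) ⊗ [b_(2)] of π_B(A) on V^1; for b ∈ B^+ one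
   has π_B(b_(1)) ⊗ b_(2) = π_B(b_(1)) ⊗ (b_(2) - ε(b_(2))1), since π_B(b) = 0. *)
Definition V1_coaction (lam : V1 -> tensor (piB B) V1) : Prop :=
  forall b : Bt, lam (V1_class b) = tmap (proj (@BpA K A B)) V1_class (hdeltaB b).

Variable lam : {linear V1 -> tensor (piB B) V1}.

(* a_(1) ⊗ π_B(a_(2)) ⊗ v = a ⊗ v_(-1) ⊗ v_(0) *)
Definition cotensor : submodClosed (tensor A V1) :=
  equalizer
    (@tassoc K A (piB B) V1 \o
       tmap (tmap idfun (proj (@BpA K A B)) \o hdelta A) idfun)
    (tmap idfun lam).

Definition Omega : relHopf B :=
  @RelHopf K A B (sub_of cotensor)
    (fun b w => insubd 0 (tmap (fun a => val b * a) idfun (\val w)))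
    (fun w => preimage_of (tmap idfun (@sub_val _ _ cotensor))
       (tassoc (tmap (hdelta A) idfun (\val w)))).

Definition OmegaOmega : relHopf B := rh_tensor Omega Omega.

Definition is_basis (V : lmodType K) n (e : 'I_n -> V) : Prop :=
  forall v, exists! c : 'I_n -> K, v = \sum_i c i *: e i.

Definition dual_bases n (X : 'I_n -> sub_of T) (e : 'I_n -> V1) : Prop :=
  [/\ is_basis X, is_basis e & forall i j, pairT (X i) (e j) = (i == j)%:R].

Definition differential n (X : 'I_n -> sub_of T) (e : 'I_n -> V1)
    (d : Bt -> Omega) : Prop :=
  forall b, \val (d b) =
    tmap idfun (fun c => \sum_i (\val (X i) c : K) *: e i) (hdeltaB b).

Section Connection.
Variables (d : Bt -> Omega) (nabla : {linear Omega -> OmegaOmega}).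

Definition connection : Prop := forall b (w : Omega),
  nabla (rh_act b w) = rh_pure (d b) w + rh_act b (nabla w).

Definition left_covariant : Prop := forall w : Omega,
  rh_coact (nabla w) = tmap idfun nabla (rh_coact w).

Definition bimodule_map (sigma : {linear OmegaOmega -> OmegaOmega}) : Prop :=
  [/\ (forall b (x : OmegaOmega), sigma (rh_act b x) = rh_act b (sigma x)),
      (forall b (x : OmegaOmega), sigma (rh_ract x b) = rh_ract (sigma x) b) &
      (forall b (w : Omega),
         nabla (rh_ract w b) = rh_ract (nabla w) b + sigma (rh_pure w (d b)))].

End Connection.

Definition Phi_identification (d : Bt -> Omega)
    (i1 : {linear Phi Omega -> V1})
    (i2 : {linear Phi OmegaOmega -> tensor (Phi Omega) (Phi Omega)}) : Prop :=
  [/\ bijective i1, bijective i2,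
      (forall b, i1 (Phi_class (d b)) = V1_class b) &
      (forall w z : Omega,
         i2 (Phi_class (rh_pure w z)) = Phi_class w ⊗ Phi_class z)].

Definition is_Phi_sigma (i1 : Phi Omega -> V1)
    (i2 : Phi OmegaOmega -> tensor (Phi Omega) (Phi Omega))
    (sigma : OmegaOmega -> OmegaOmega) (sigmaV : tensor V1 V1 -> tensor V1 V1) :=
  forall x, sigmaV (tmap i1 i1 (i2 x)) = tmap i1 i1 (i2 (Phi_map sigma x)).

Definition pairTT (s : tensor (sub_of T) (sub_of T)) (t : tensor V1 V1) : K^o :=
  tlift (fun X Y => tlift (fun v w => pairT X v * pairT Y w : K^o) t) s.

Definition is_dual_map (sigmaV : tensor V1 V1 -> tensor V1 V1)
    (sigmaC : tensor (sub_of T) (sub_of T) -> tensor (sub_of T) (sub_of T)) :=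
  forall X Y v w, pairTT (sigmaC (X ⊗ Y)) (v ⊗ w) = pairTT (X ⊗ Y) (sigmaV (v ⊗ w)).

(* [f] as an element of [T]; the value is 0 when [f] is not in [T]. *)
Definition in_T (f : Bt -> K^o) : sub_of T := insubd 0 f.

End Calculus.

(* Main.v *)
Require Import Defs.
From HB Require Import structures.
From mathcomp Require Import all_boot all_order all_algebra.
From mathcomp Require Import boolp classical_sets functions reals complex.
From mathcomp Require Import ring.

Set Implicit Arguments.
Unset Strict Implicit.
Unset Printing Implicit Defensive.

Import GRing.Theory.
Local Open Scope ring_scope.

(** The bimodule map is determined by covariance alone:
    σ(dc ⊗ db) = ∇((dc) b) - ∇(dc) b, where the right action is
    (dc) b = (c_(1) b S(c_(2))) dc_(3). As ∇ is a comodule map, ∇(dc) b is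
    (c_(1) b S(c_(2))) ∇(dc_(3)), which is also what the Leibniz rule produces
    in ∇((dc) b) besides d(c_(1) b S(c_(2))) ⊗ dc_(3). Hence

      σ([c] ⊗ [b]) = [c_(1) b S(c_(2))] ⊗ [c_(3)]       ([sigmaV_class]),

    and the dual map pairs lE ⊗ Y with [c] ⊗ [b] to
    (l E)(c_(1) b S(c_(2))) Y(c_(3)).

    The elements of L act on B through the counit and so vanish on B^+. Let b
    be in B^+. Expanding the iterated coproducts of l and of the skew-primitive
    E over the product x b z, every term that puts an element of L on b is
    therefore zero, and what is left is the sum of
    (l_(1) K_2)(x) (l_(2) E)(b) (l_(3) K_1)(z)          ([conv_skew_sandwich]).
    At z = S(c) the last factor is (K_1^-1 S(l_(3)))(c), because the antipode
    reverses coproducts and the dual antipode inverts grouplike elements; the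
    factors evaluated at legs of c then recombine into the action of
    l_(1) K_2 K_1^-1 S(l_(3)) on Y. Elements of the tensor square of T are
    separated by their pairings with [c] ⊗ [b] ([pairTT_nondegenerate]), since T
    has a basis with a dual basis in V^1.

    Two preliminaries carry the rest. Several structures are defined by
    preimages under maps such as the inclusion of B ⊗ M in A ⊗ M; these are
    injective because linear injections have linear retractions
    ([linear_retraction]). And a_(1) b S(a_(2)) belongs to B
    ([ad_invariants]). *)

(** * Tensors as finite sums *)

Section TensorSums.
Variables (K : fieldType) (V W : lmodType K).

Lemma tens_ex (t : tensor V W) :
  exists s : seq (V * W), t = \sum_(p <- s) p.1 ⊗ p.2.
Proof.
have [n [v [w ->]]] := tensor_sum t.
by exists [seq (v i, w i) | i <- enum 'I_n]; rewrite big_map big_enum.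
Qed.

(** Sweedler notation: a chosen decomposition into pure tensors, so that an
    identity of tensors becomes an identity of sums after applying any
    multilinear map. *)
Definition tens (t : tensor V W) : seq (V * W) := sval (cid (tens_ex t)).

Lemma tensE (t : tensor V W) : t = \sum_(p <- tens t) p.1 ⊗ p.2.
Proof. exact: svalP (cid (tens_ex t)). Qed.

Variable P : lmodType K.

Lemma lin_sum (U : lmodType K) (f : U -> P) I (s : seq I) (F : I -> U) :
  linear f -> f (\sum_(i <- s) F i) = \sum_(i <- s) f (F i).
Proof.
move=> fL; pose g : {linear U -> P} :=
  HB.pack f (GRing.isLinear.Build K _ _ _ _ fL).
exact: (linear_sum g).
Qed.

Lemma tlift_sumE (f : V -> W -> P) I (s : seq I) (F : I -> V) (G : I -> W) :
  bilinear2 f ->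
  tlift f (\sum_(i <- s) F i ⊗ G i) = \sum_(i <- s) f (F i) (G i).
Proof.
move=> fB; rewrite (lin_sum _ _ (tlift_linear fB)).
by apply: eq_bigr => i _; rewrite tliftE.
Qed.

Lemma tlift_tens (f : V -> W -> P) (t : tensor V W) : bilinear2 f ->
  tlift f t = \sum_(p <- tens t) f p.1 p.2.
Proof. by move=> fB; rewrite {1}[t]tensE tlift_sumE. Qed.

End TensorSums.

Section TensorMaps.
Variable K : fieldType.
Implicit Types V W U M P : lmodType K.

Lemma pure_linl V W (w : W) : linear (fun v : V => v ⊗ w).
Proof. exact: (pure_bilinear _ _).1. Qed.

Lemma pure_linr V W (v : V) : linear (fun w : W => v ⊗ w).
Proof. exact: (pure_bilinear _ _).2. Qed.

(** Maps such as coactions are only known to be linear propositionally; this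
    gives access to the lemmas on bundled linear maps. *)
Lemma linear_ex V P (f : V -> P) : linear f ->
  exists g : {linear V -> P}, f = g.
Proof.
move=> fL; pose g : {linear V -> P} :=
  HB.pack f (GRing.isLinear.Build K _ _ _ _ fL).
by exists g.
Qed.

Lemma tmap_tens V V' W W' (f : V -> V') (g : W -> W') (t : tensor V W) :
  linear f -> linear g ->
  tmap f g t = \sum_(p <- tens t) f p.1 ⊗ g p.2.
Proof.
move=> /linear_ex[f' ->] /linear_ex[g' ->].
by rewrite /tmap tlift_tens//; exact: tmap_bilinear.
Qed.

Lemma tmapE V V' W W' (f : V -> V') (g : W -> W') v w :
  linear f -> linear g -> tmap f g (v ⊗ w) = f v ⊗ g w.
Proof.
move=> /linear_ex[f' ->] /linear_ex[g' ->].
by rewrite /tmap tliftE//; exact: tmap_bilinear.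
Qed.

Lemma tmap_lin V V' W W' (f : V -> V') (g : W -> W') :
  linear f -> linear g -> linear (tmap f g).
Proof.
by move=> /linear_ex[f' ->] /linear_ex[g' ->]; exact: tmap_linear.
Qed.

Lemma tmap_comp V V' V'' W W' W'' (f : V -> V') (g : W -> W')
    (f' : V' -> V'') (g' : W' -> W'') t :
  linear f -> linear g -> linear f' -> linear g' ->
  tmap f' g' (tmap f g t) = tmap (f' \o f) (g' \o g) t.
Proof.
move=> fL gL f'L g'L.
have f2L : linear (f' \o f) by move=> a x y /=; rewrite fL f'L.
have g2L : linear (g' \o g) by move=> a x y /=; rewrite gL g'L.
rewrite [tmap f g t]tmap_tens// (lin_sum _ _ (tmap_lin f'L g'L)) [RHS]tmap_tens//.
by apply: eq_bigr => p _; rewrite tmapE.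
Qed.

Definition trilinear U V W P (f : U -> V -> W -> P) : Prop :=
  [/\ forall y z, linear (fun x => f x y z),
      forall x z, linear (fun y => f x y z) &
      forall x y, linear (f x y)].

(** Coassociativity of a coaction delta, read through a trilinear map. *)
Lemma coassoc_tens U M P (D : U -> tensor U U) (delta : M -> tensor U M)
    (f : U -> U -> M -> P) m :
  linear D -> linear delta -> trilinear f ->
  tassoc (tmap D idfun (delta m)) = tmap idfun delta (delta m) ->
  \sum_(p <- tens (delta m)) \sum_(q <- tens (D p.1)) f q.1 q.2 p.2 =
  \sum_(p <- tens (delta m)) \sum_(q <- tens (delta p.2)) f p.1 q.1 q.2.
Proof.
move=> DL dL [f1 f2 f3]; rewrite !tmap_tens//; try by move=> ? ? ?.
have fB x : bilinear2 (f x) by split=> [z|y]; [exact: f2|exact: f3].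
pose F (x : U) t := tlift (f x) t.
have FB : bilinear2 F.
  split=> [t a x y|x]; last exact/tlift_linear.
  rewrite /F !tlift_tens// scaler_sumr -big_split/=.
  by apply: eq_bigr => q _; rewrite f1.
have aL : linear (@tassoc K U U M) by exact: linearP.
move=> /(congr1 (tlift F)); rewrite (lin_sum _ _ aL).
rewrite !(lin_sum _ _ (tlift_linear FB)).
under eq_bigr => p _.
  rewrite {1}[D p.1]tensE.
  rewrite (lin_sum (f := fun t => t ⊗ p.2)); last exact: pure_linl.
  rewrite (lin_sum _ _ aL) (lin_sum _ _ (tlift_linear FB)).
  under eq_bigr do rewrite tassocE tliftE// /F tliftE//.
  over.
move=> ->; apply: eq_bigr => p _.
by rewrite tliftE// /F tlift_tens.
Qed.

End TensorMaps.

(** * Injective linear maps *)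

Section Injective.
Variable K : fieldType.
Implicit Types V W U M P : lmodType K.

(** A maximal subspace U meeting the image of f trivially is a complement of
    it, and the retraction is the projection along U. Zorn's lemma is applied to
    sets that are merely closed under a u + v, so that the empty chain needs no
    separate treatment. *)
Lemma linear_retraction V V' (f : V -> V') : linear f -> injective f ->
  exists2 r : V' -> V, linear r & cancel f r.
Proof.
move=> fL fI.
have f0 : f 0 = 0 by have [g ->] := linear_ex fL; rewrite linear0.
pose P (U : set V') := (forall (a : K) u v, U u -> U v -> U (a *: u + v)) /\
  (forall v, U (f v) -> v = 0).
have [F FP Ft|U [[UL U0] Umax]] := @Zorn_bigcup V' P.
  split=> [a u v [X FX Xu] [Y FY Yv]|v [X FX Xv]]; last exact: (FP _ FX).2 Xv.
  have [XY|YX] := Ft _ _ FX FY.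
    by exists Y => //; apply: (FP _ FY).1 => //; exact: XY.
  by exists X => //; apply: (FP _ FX).1 => //; exact: YX.
have Uz : U 0.
  apply: contrapT => nU0; have Ue x : ~ U x.
    by move=> Ux; apply: nU0; have := UL (-1) x x Ux Ux; rewrite scaleN1r addNr.
  apply: (Umax [set 0]%classic).
    split=> [x /Ue//|/(_ 0 erefl)]; exact: nU0.
  split=> [a u v -> ->|v /= fv]; first by rewrite /= scaler0 addr0.
  by apply: fI; rewrite f0.
have Us (a : K) u : U u -> U (a *: u).
  by move=> Uu; have := UL a u 0 Uu Uz; rewrite addr0.
have dec x : exists v, U (x - f v).
  apply: contrapT => nx.
  pose U' : set V' := [set y | exists k u, U u /\ y = u + k *: x]%classic.
  apply: (Umax U').
    split=> [y Uy|sU]; first by exists 0, y; rewrite scale0r addr0.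
    apply: nx; exists 0; rewrite f0 subr0; apply: sU.
    by exists 1, 0; rewrite scale1r add0r.
  split=> [a _ _ [k [u [Uu ->]]] [k' [u' [Uu' ->]]]|v [k [u [Uu fv]]]].
    exists (a * k + k'), (a *: u + u'); split; first exact: UL.
    by rewrite scalerDr scalerDl scalerA addrACA.
  have [k0|k0] := eqVneq k 0.
    by apply: U0; rewrite fv k0 scale0r addr0.
  exfalso; apply: nx; exists (k^-1 *: v).
  have -> : f (k^-1 *: v) = k^-1 *: f v.
    by have := fL k^-1 v 0; rewrite !addr0 f0 addr0.
  rewrite fv scalerDr scalerA mulVf// scale1r opprD addrCA subrr addr0 -scaleNr.
  exact: Us.
pose r x := sval (cid (dec x)).
have rP x : U (x - f (r x)) by rewrite /r; case: (cid (dec x)).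
have rU x v : U (x - f v) -> r x = v.
  move=> Uv; apply/eqP; rewrite -subr_eq0; apply/eqP/U0.
  have -> : f (r x - v) = (-1) *: (x - f (r x)) + (x - f v).
    have [g fg] := linear_ex fL; rewrite fg linearB scaleN1r opprB.
    by rewrite addrA subrK.
  exact: UL.
exists r => [a x y|v]; last by apply: rU; rewrite subrr.
apply: rU; rewrite fL.
have -> : a *: x + y - (a *: f (r x) + f (r y)) =
  a *: (x - f (r x)) + (y - f (r y)) by rewrite scalerBr opprD addrACA.
exact: UL.
Qed.

Lemma tmap_inj V V' W W' (f : V -> V') (g : W -> W') :
  linear f -> linear g -> injective f -> injective g -> injective (tmap f g).
Proof.
move=> fL gL fI gI.
have [r rL rK] := linear_retraction fL fI.
have [s sL sK] := linear_retraction gL gI.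
apply: (can_inj (g := tmap r s)) => t; rewrite tmap_comp// tmap_tens.
- by rewrite [RHS]tensE; apply: eq_bigr => p _ /=; rewrite rK sK.
- by move=> a x y /=; rewrite fL rL.
- by move=> a x y /=; rewrite gL sL.
Qed.

Lemma span_kernel V P (R : V -> Prop) (h : V -> P) x : linear h ->
  (forall y, R y -> h y = 0) -> x \in Defs.span R -> h x = 0.
Proof.
move=> hL hR /asboolP[n [c [v [Rv ->]]]]; rewrite (lin_sum _ _ hL).
apply: big1 => i _; have [g gE] := linear_ex hL.
by rewrite gE linearZ -gE /= hR// scaler0.
Qed.

Lemma qrepr_proj V P (R : V -> Prop) (h : V -> P) x : linear h ->
  (forall y, R y -> h y = 0) -> h (qrepr (proj R x)) = h x.
Proof.
move=> hL hR; apply/eqP; rewrite -subr_eq0; apply/eqP.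
have -> : h (qrepr (proj R x)) - h x = h (qrepr (proj R x) - x).
  by have [g ->] := linear_ex hL; rewrite linearB.
by apply: (span_kernel hL hR); apply/proj_eq; rewrite qreprK.
Qed.

(** Together with [tmap_inj], this evaluates the coproduct of B, the coaction
    of the calculus and the right action of a relative Hopf module, which are
    all given as preimages under injective maps. *)
Lemma preimage_ofK (X : zmodType) (Y : Type) (f : X -> Y) x :
  injective f -> preimage_of f (f x) = x.
Proof.
move=> fI; rewrite /preimage_of; apply: fI.
by apply: (@xgetPex _ 0 [set z | f z = f x]%classic); exists x.
Qed.

End Injective.

(** * Rewriting with multilinear operations *)

Section MultilinearRules.
Variable K : fieldType.

Lemma linZ (V P : lmodType K) (f : V -> P) a u : linear f -> f (a *: u) = a *: f u.
Proof. by move=> /linear_ex[g ->]; exact: linearZ. Qed.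

Lemma mulPl (A : lalgType K) (a : K) (u v c : A) :
  (a *: u + v) * c = a *: (u * c) + v * c.
Proof. by rewrite mulrDl scalerAl. Qed.

Lemma mulPr (A : algType K) (a : K) (u v c : A) :
  c * (a *: u + v) = a *: (c * u) + c * v.
Proof. by rewrite mulrDr scalerAr. Qed.

Lemma scalePl (V : lmodType K) (a : K) (u v : K^o) (w : V) :
  ((a *: u + v : K^o) : K) *: w = a *: ((u : K) *: w) + (v : K) *: w.
Proof. by rewrite scalerDl scalerA. Qed.

Lemma scalePr (V : lmodType K) (a c : K) (u v : V) :
  c *: (a *: u + v) = a *: (c *: u) + c *: v.
Proof. by rewrite scalerDr !scalerA mulrC. Qed.

Lemma purePl (V W : lmodType K) (a : K) (u v : V) (w : W) :
  (a *: u + v) ⊗ w = a *: (u ⊗ w) + v ⊗ w.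
Proof. exact: pure_linl. Qed.

Lemma purePr (V W : lmodType K) (a : K) (w : V) (u v : W) :
  w ⊗ (a *: u + v) = a *: (w ⊗ u) + w ⊗ v.
Proof. exact: pure_linr. Qed.

Lemma linear_big (V P : lmodType K) I (s : seq I) (F : I -> V -> P) :
  (forall i, linear (F i)) -> linear (fun x => \sum_(i <- s) F i x).
Proof.
move=> FL a x y; rewrite scaler_sumr -big_split/=; apply: eq_bigr => i _.
exact: FL.
Qed.

Lemma linear_tens (V U W P : lmodType K) (D : V -> tensor U W)
    (f : U -> W -> P) :
  linear D -> bilinear2 f ->
  linear (fun x => \sum_(p <- tens (D x)) f p.1 p.2).
Proof.
by move=> DL fB a x y /=; rewrite -!tlift_tens// DL (tlift_linear fB).
Qed.

Lemma mulK_linl (a : K) (u v : K^o) (c : K^o) :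
  (a *: u + v) * c = a *: (u * c) + v * c.
Proof. exact: mulPl. Qed.

Lemma mulK_linr (a : K) (u v : K^o) (c : K^o) :
  c * (a *: u + v) = a *: (c * u) + c * v.
Proof. exact: mulPr. Qed.

Lemma mul_bilinear (V W : lmodType K) (f : V -> K^o) (g : W -> K^o) :
  linear f -> linear g ->
  bilinear2 (fun x y => f x * g y : K^o).
Proof.
move=> fL gL; split=> [w|w] k u v /=.
  by rewrite fL mulK_linl.
by rewrite gL mulK_linr.
Qed.

End MultilinearRules.

(** Linearity of an expression in one variable: each rule moves a u + v out
    through one operation. *)
Ltac lin :=
  move=> ? ? ? /=;
  rewrite ?(linearP, mulPl, mulPr, scalePl, scalePr, purePl, purePr) //=.

(** * Sweedler calculus in a Hopf algebra *)

Section Sweedler.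
Variables (K : fieldType) (A : hopfAlg K).
Implicit Types (P : lmodType K).

Definition sw (a : A) := tens (hdelta A a).
Local Notation S := (hS A).
Local Notation eps := (heps A).

Lemma hdeltaL : linear (hdelta A). Proof. exact: linearP. Qed.

Lemma sw_linear P (f : A -> A -> P) : bilinear2 f ->
  linear (fun a => \sum_(p <- sw a) f p.1 p.2).
Proof. exact/linear_tens/hdeltaL. Qed.

Lemma sw_assoc P (f : A -> A -> A -> P) a : trilinear f ->
  \sum_(p <- sw a) \sum_(q <- sw p.1) f q.1 q.2 p.2 =
  \sum_(p <- sw a) \sum_(q <- sw p.2) f p.1 q.1 q.2.
Proof.
move=> fT; apply: coassoc_tens => //; try exact: hdeltaL.
exact: hdelta_coassoc.
Qed.

Lemma sw_mul P (f : A -> A -> P) a b : bilinear2 f ->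
  \sum_(p <- sw (a * b)) f p.1 p.2 =
  \sum_(p <- sw a) \sum_(q <- sw b) f (p.1 * q.1) (p.2 * q.2).
Proof.
move=> fB; pose g x y := tlift (fun z t => (x * z) ⊗ (y * t)) (hdelta A b).
have gE x y : g x y = \sum_(q <- sw b) (x * q.1) ⊗ (y * q.2).
  by rewrite /g tlift_tens//; split=> [z|z]; lin.
have gB : bilinear2 g.
  split=> [y a' x x'|x a' y y']; rewrite !gE scaler_sumr -big_split;
  by apply: eq_bigr => q _; rewrite mulPl ?purePl ?purePr.
rewrite -tlift_tens// hdeltaM -/g [tlift g _]tlift_tens//.
rewrite (lin_sum _ _ (tlift_linear fB)); apply: eq_bigr => p _.
by rewrite gE tlift_sumE.
Qed.

Lemma sw_one P (f : A -> A -> P) : bilinear2 f ->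
  \sum_(p <- sw 1) f p.1 p.2 = f 1 1.
Proof. by move=> fB; rewrite -tlift_tens// hdelta1 tliftE. Qed.

Lemma sw_epsl P (f : A -> P) a : linear f ->
  \sum_(p <- sw a) (eps p.1 : K) *: f p.2 = f a.
Proof.
move=> /linear_ex[g ->]; rewrite -[in RHS](heps_counitl a) tlift_tens; last first.
  by split=> [z|z]; lin.
by rewrite linear_sum; apply: eq_bigr => p _; rewrite linearZ.
Qed.

Lemma sw_epsr P (f : A -> P) a : linear f ->
  \sum_(p <- sw a) (eps p.2 : K) *: f p.1 = f a.
Proof.
move=> /linear_ex[g ->]; rewrite -[in RHS](heps_counitr a) tlift_tens; last first.
  by split=> [z|z]; lin.
by rewrite linear_sum; apply: eq_bigr => p _; rewrite linearZ.
Qed.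

Lemma sw_Sl P (f : A -> P) a : linear f ->
  \sum_(p <- sw a) f (S p.1 * p.2) = (eps a : K) *: f 1.
Proof.
move=> /linear_ex[g ->]; rewrite -linearZ -hS_left tlift_tens; last first.
  by split=> [z|z]; lin.
by rewrite linear_sum.
Qed.

Lemma sw_Sr P (f : A -> P) a : linear f ->
  \sum_(p <- sw a) f (p.1 * S p.2) = (eps a : K) *: f 1.
Proof.
move=> /linear_ex[g ->]; rewrite -linearZ -hS_right tlift_tens; last first.
  by split=> [z|z]; lin.
by rewrite linear_sum.
Qed.

End Sweedler.

Arguments sw_linear [K A P] f _.
Arguments sw_assoc [K A P] f [a] _.
Arguments sw_mul [K A P] f [a b] _.
Arguments sw_one [K A P] f _.
Arguments sw_epsl [K A P] f [a] _.
Arguments sw_epsr [K A P] f [a] _.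
Arguments sw_Sl [K A P] f [a] _.
Arguments sw_Sr [K A P] f [a] _.

(** * The antipode reverses products and coproducts *)

Section Antipode.
Variables (K : fieldType) (A : hopfAlg K).
Implicit Types (P : lmodType K).
Local Notation S := (hS A).
Local Notation eps := (heps A).

Lemma bilinear_eqs (V W P : lmodType K) (f : V -> W -> P) : bilinear2 f ->
  (forall (a : K) u v w, f (a *: u + v) w = a *: f u w + f v w) *
  (forall (a : K) u v w, f w (a *: u + v) = a *: f w u + f w v).
Proof. by case=> f1 f2; split=> a u v w; [exact: f1|exact: f2]. Qed.

(** S(a_(2)) a_(3) ⊗ S(a_(1)) a_(4) = ε(a) 1 ⊗ 1, seen through f: the map
    a |-> S(a_(2)) ⊗ S(a_(1)) is a left convolution inverse of Δ. *)
Lemma sw_Sl2 P (f : A -> A -> P) a : bilinear2 f ->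
  \sum_(p <- sw a) \sum_(q <- sw p.1) \sum_(r <- sw p.2)
    f (S q.2 * r.1) (S q.1 * r.2) = (eps a : K) *: f 1 1.
Proof.
move=> fB; have fE := bilinear_eqs fB.
rewrite (sw_assoc (fun x y z => \sum_(r <- sw z) f (S y * r.1) (S x * r.2))).
  under eq_bigr => p _.
    rewrite -(sw_assoc (fun x y z => f (S x * y) (S p.1 * z))); last first.
      by split=> y z; lin; rewrite fE.
    under eq_bigr => q _.
      rewrite (sw_Sl (fun x => f x (S p.1 * q.2))); last by lin; rewrite fE.
      over.
    rewrite (sw_epsl (fun x => f 1 (S p.1 * x))); last by lin; rewrite fE.
    over.
  by rewrite (sw_Sl (f 1)); last by move=> ? ? ?; rewrite fE.
split=> [y z|x z|x y].
- by apply: linear_big => r; lin; rewrite fE.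
- by apply: linear_big => r; lin; rewrite fE.
- apply: (sw_linear (fun r1 r2 => f (S y * r1) (S x * r2))).
  by split=> w; lin; rewrite fE.
Qed.

(** The antipode is an anti-coalgebra map. Both sides are convolution inverses
    of Δ, so both equal the threefold product H below, bracketed in its two
    ways. *)
Lemma sw_antipode P (f : A -> A -> P) a : bilinear2 f ->
  \sum_(p <- sw (S a)) f p.1 p.2 = \sum_(p <- sw a) f (S p.2) (S p.1).
Proof.
move=> fB; have fE := bilinear_eqs fB.
pose H x y z := \sum_(p <- sw x) \sum_(q <- sw y) \sum_(r <- sw (S z))
  f (S p.2 * (q.1 * r.1)) (S p.1 * (q.2 * r.2)).
have HT : trilinear H.
  split=> [y z|x z|x y]; rewrite /H.
  - apply: (sw_linear (fun p1 p2 => \sum_(q <- sw y) \sum_(r <- sw (S z))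
      f (S p2 * (q.1 * r.1)) (S p1 * (q.2 * r.2)))).
    by split=> w; do 2!apply: linear_big => ?; lin; rewrite fE.
  - apply: linear_big => p.
    apply: (sw_linear (fun q1 q2 => \sum_(r <- sw (S z))
      f (S p.2 * (q1 * r.1)) (S p.1 * (q2 * r.2)))).
    by split=> w; apply: linear_big => ?; lin; rewrite fE.
  - do 2!apply: linear_big => ?.
    move=> k u v; rewrite linearP.
    apply: (sw_linear (fun r1 r2 => f (S _ * (_ * r1)) (S _ * (_ * r2)))).
    by split=> w; lin; rewrite fE.
have eH := sw_assoc H (a := a) HT.
transitivity (\sum_(p <- sw a) \sum_(q <- sw p.1) H q.1 q.2 p.2).
  under [RHS]eq_bigr => p _.
    rewrite /H.
    under eq_bigr => q _.
      rewrite (eq_bigr _ (fun s _ => exchange_big _ _ _ _ _ _)).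
      rewrite exchange_big /=.
      over.
    rewrite exchange_big /=.
    under eq_bigr => r _.
      under eq_bigr => q _.
        under eq_bigr do under eq_bigr do rewrite !mulrA.
        over.
      rewrite (@sw_Sl2 P (fun x y => f (x * r.1) (y * r.2))); last first.
        by split=> w; lin; rewrite fE.
      rewrite !mul1r.
      over.
    rewrite -scaler_sumr.
    over.
  rewrite (sw_epsl (fun z => \sum_(r <- sw (S z)) f r.1 r.2))//.
  by move=> k u v; rewrite linearP; exact: (sw_linear _ fB).
rewrite eH.
under eq_bigr => p _.
  under eq_bigr => q _.
    rewrite /H; over.
  rewrite exchange_big /=.
  under eq_bigr => s _.
    under eq_bigr => q _.
      rewrite -(sw_mul (fun x y => f (S s.2 * x) (S s.1 * y))); last first.
        by split=> w; lin; rewrite fE.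
      over.
    rewrite (sw_Sr (fun t => \sum_(u <- sw t) f (S s.2 * u.1) (S s.1 * u.2))).
      rewrite (sw_one (fun x y => f (S s.2 * x) (S s.1 * y))) ?mulr1.
        over.
      by split=> w; lin; rewrite fE.
    apply: (sw_linear (fun x y => f (S s.2 * x) (S s.1 * y))).
    by split=> w; lin; rewrite fE.
  rewrite -scaler_sumr.
  over.
apply: (sw_epsr (fun x => \sum_(s <- sw x) f (S s.2) (S s.1))).
apply: (sw_linear (fun x y => f (S y) (S x))).
by split=> w; lin; rewrite fE.
Qed.

(** The dual argument: S(xy) and S(y) S(x) are both convolution inverses of the
    multiplication, and G1 is the threefold product S(x_(1)y_(1)) x_(2)y_(2)
    S(y_(3)) S(x_(3)). *)
Lemma antipodeM x y : S (x * y) = S y * S x.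
Proof.
pose G1 a b c d e g := S (a * d) * (b * e) * (S g * S c).
transitivity (\sum_(p <- sw x) \sum_(q <- sw p.2)
   \sum_(r <- sw y) \sum_(s <- sw r.2) G1 p.1 q.1 q.2 r.1 s.1 s.2).
  under eq_bigr => p _.
    under eq_bigr => q _.
      under eq_bigr => r _.
        under eq_bigr => s _ do rewrite /G1 -mulrA -(mulrA q.1) [s.1 * _]mulrA.
        rewrite (sw_Sr (fun t => S (p.1 * r.1) * (q.1 * (t * S q.2)))).
          rewrite mul1r.
          over.
        by lin.
      rewrite (sw_epsr (fun t => S (p.1 * t) * (q.1 * S q.2))); last by lin.
      over.
    rewrite (sw_Sr (fun t => S (p.1 * y) * t)); last by lin.
    rewrite mulr1.
    over.
  by rewrite (sw_epsr (fun t => S (t * y)))//; lin.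
have e1 p : \sum_(q <- sw p.2) \sum_(r <- sw y) \sum_(s <- sw r.2)
     G1 p.1 q.1 q.2 r.1 s.1 s.2 = \sum_(r <- sw y) \sum_(s <- sw r.1)
   \sum_(q <- sw p.2) G1 p.1 q.1 q.2 s.1 s.2 r.2.
  rewrite exchange_big /=.
  rewrite [RHS](eq_bigr _ (fun r _ => exchange_big _ _ _ _ _ _)) [RHS]exchange_big /=.
  rewrite exchange_big/=; apply: eq_bigr => q _.
  by rewrite (sw_assoc (G1 p.1 q.1 q.2))// /G1; split=> ? ?; lin.
under eq_bigr do rewrite e1.
rewrite exchange_big /=.
under eq_bigr => r _.
  rewrite exchange_big /=.
  under eq_bigr => s _.
    rewrite -(sw_assoc (fun a b c => G1 a b c s.1 s.2 r.2)); last first.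
      by rewrite /G1; split=> ? ?; lin.
    over.
  rewrite exchange_big /=.
  under eq_bigr => p _.
    rewrite exchange_big /=.
    under eq_bigr => q _.
      rewrite /G1.
      over.
    rewrite -(sw_mul (fun a b => S a * b * (S r.2 * S p.2))); last first.
      by split=> w; lin.
    rewrite (sw_Sl (fun a => a * (S r.2 * S p.2))); last by lin.
    rewrite mul1r.
    over.
  over.
under eq_bigr => r _.
  under eq_bigr => p _ do rewrite hepsM -scalerA.
  rewrite (sw_epsl (fun t => (eps r.1 : K) *: (S r.2 * S t))); last by lin.
  over.
by rewrite (sw_epsl (fun t => S t * S x)); last by lin.
Qed.

End Antipode.

(** * Functionals, invariants and the adjoint action *)

Section Functionals.
Variables (K : fieldType) (A : hopfAlg K).
Implicit Types (f g h : A -> K^o) (a b x z : A).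
Local Notation S := (hS A).
Local Notation eps := (heps A).

Lemma conv_sw f g a : linear f -> linear g ->
  conv f g a = \sum_(p <- sw a) f p.1 * g p.2.
Proof. by move=> fL gL; rewrite /conv tlift_tens//; exact: mul_bilinear. Qed.

Lemma conv_linear f g : linear f -> linear g -> linear (conv f g).
Proof.
move=> fL gL k u v; rewrite /conv linearP.
exact/tlift_linear/mul_bilinear.
Qed.

Lemma convA f g h : linear f -> linear g -> linear h ->
  conv f (conv g h) = conv (conv f g) h.
Proof.
move=> fL gL hL; apply/funext => a.
have fgL := conv_linear fL gL; have ghL := conv_linear gL hL.
rewrite !conv_sw//.
under eq_bigr do rewrite conv_sw// mulr_sumr.
under [RHS]eq_bigr do rewrite conv_sw// mulr_suml.
rewrite (sw_assoc (fun x y z => f x * g y * h z)); last first.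
  split=> [y z|x z|x y] k u v.
  - by rewrite fL !mulK_linl.
  - by rewrite gL mulK_linr mulK_linl.
  - by rewrite hL mulK_linr.
by apply: eq_bigr => p _; apply: eq_bigr => q _; rewrite mulrA.
Qed.

Lemma heps_linear : linear (eps : A -> K^o). Proof. exact: linearP. Qed.

Lemma conv_epsl f : linear f -> conv eps f = f.
Proof.
move=> fL; apply/funext => a; rewrite conv_sw//; last exact: heps_linear.
exact: (sw_epsl f).
Qed.

Lemma conv_epsr f : linear f -> conv f eps = f.
Proof.
move=> fL; apply/funext => a; rewrite conv_sw//; last exact: heps_linear.
rewrite -[RHS](sw_epsr f)//.
by apply: eq_bigr => p _; rewrite mulrC.
Qed.

Lemma dualS_linear f : linear f -> linear (@dualS K A f).
Proof. by move=> fL k u v; rewrite /dualS linearP fL. Qed.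

Lemma grouplike_inverse (k k' : A -> K^o) :
  grouplike k -> conv_inverse k k' -> k' = dualS k.
Proof.
move=> [[kL _] k1 kM] [[k'L _] kk' _].
have SkL := dualS_linear kL.
rewrite -[RHS]conv_epsr// -kk' convA// -[LHS]conv_epsl//; congr (conv _ _).
apply/funext => a; rewrite conv_sw//.
under eq_bigr do rewrite /dualS -kM.
rewrite (sw_Sl k)// k1; exact/esym/mulr1.
Qed.

Lemma conv_dualS f g : linear f -> linear g ->
  conv f g \o S = conv (dualS g) (dualS f).
Proof.
move=> fL gL; apply/funext => a /=.
rewrite !conv_sw//; try exact: dualS_linear.
rewrite (sw_antipode _ (mul_bilinear fL gL)).
by apply: eq_bigr => p _; rewrite mulrC.
Qed.

Variables (L : submodClosed (A -> K^o)) (hL : hopf_subalgebra L).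

Lemma hopf_linear l : l \in L -> linear l.
Proof. by case: hL => + _ _ _ _ => /[apply] -[]. Qed.

Lemma invariants_sw b l : invariants L b -> l \in L ->
  \sum_(p <- sw b) (l p.2 : K) *: p.1 = (l 1 : K) *: b.
Proof.
move=> bI lL; rewrite -bI// tlift_tens//.
have lL' := hopf_linear lL.
by split=> [w|w] k u v /=; rewrite ?lL' ?scalePl ?scalePr.
Qed.

(** Elements of L act on B through the counit; in particular they vanish on
    B^+. *)
Lemma invariants_eps b l : invariants L b -> l \in L -> l b = l 1 * eps b.
Proof.
move=> bI lL; have /(congr1 eps) := invariants_sw bI lL.
rewrite linearZ linear_sum /= => h; apply: etrans h.
rewrite -[LHS](sw_epsl l); last exact: hopf_linear.
by apply: eq_bigr => p _; rewrite linearZ; exact: mulrC.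
Qed.

(** Invariance survives multiplication on both sides: the coproduct of l puts
    an element of L on the middle factor b_(2), which it sees as the counit. *)
Lemma invariants_sandwich b l x z : invariants L b -> l \in L ->
  \sum_(p <- sw b) (l (x * p.2 * z) : K) *: p.1 = (l (x * z) : K) *: b.
Proof.
move=> bI lL; have [_ _ _ _ LD] := hL.
have [n [l1 [l2 [l12 lE]]]] := LD _ lL.
have E1 y : l (x * (y * z)) = \sum_i l1 i x * l2 i (y * z) by rewrite lE.
have E2 i : exists n' (m1 m2 : 'I_n' -> A -> K^o),
  (forall j, m1 j \in L /\ m2 j \in L) /\ coprod2 (l2 i) m1 m2.
  by apply: LD; case: (l12 i).
rewrite -[in RHS](mul1r z) E1.
under eq_bigr do rewrite -mulrA E1 scaler_suml.
rewrite exchange_big scaler_suml; apply: eq_bigr => i _ /=.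
have [n' [m1 [m2 [m12 mE]]]] := E2 i.
under eq_bigr do rewrite mE mulr_sumr scaler_suml.
rewrite exchange_big mE mulr_sumr scaler_suml; apply: eq_bigr => j _ /=.
under eq_bigr do rewrite mulrCA mulrC -scalerA.
rewrite -scaler_sumr invariants_sw//; last by case: (m12 j).
by rewrite scalerA mulrAC mulrA.
Qed.

(** a |-> a_(1) b S(a_(2)), the left adjoint action on b. *)
Definition ad (b a : A) : A :=
  tlift (fun x y => x * b * S y) (hdelta A a).

Lemma ad_bilinear b : bilinear2 (fun x y => x * b * S y).
Proof. by split=> w; lin. Qed.

Lemma adE b a : ad b a = \sum_(p <- sw a) p.1 * b * S p.2.
Proof. by rewrite /ad tlift_tens//; exact: ad_bilinear. Qed.

Lemma ad_linear b : linear (ad b).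
Proof.
by move=> k u v; rewrite /ad linearP; exact/tlift_linear/ad_bilinear.
Qed.

(** The coproduct of a_(1) b S(a_(2)) is
    a_(1) b_(1) S(a_(4)) ⊗ a_(2) b_(2) S(a_(3)). Evaluating l on the second leg
    removes b_(2) by [invariants_sandwich], after which a_(2) S(a_(3))
    collapses. *)
Lemma ad_invariants b a : invariants L b -> invariants L (ad b a).
Proof.
move=> bI l lL; have lL' := hopf_linear lL.
have gB : bilinear2 (fun x y : A => (l y : K) *: x).
  by split=> [w|w] k u v /=; rewrite ?lL' ?scalePl ?scalePr.
pose F x y z := \sum_(w <- sw z) (l (y * S w.1) : K) *: (x * b * S w.2).
rewrite tlift_tens//.
rewrite adE (lin_sum _ _ (sw_linear _ gB)) scaler_sumr.
transitivity (\sum_(p <- sw a) \sum_(u <- sw p.1) F u.1 u.2 p.2).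
  apply: eq_bigr => p _.
  rewrite (sw_mul (fun x y => (l y : K) *: x))//.
  rewrite (sw_mul (fun x y => \sum_(q <- sw (S p.2))
      (l (y * q.2) : K) *: (x * q.1))); last first.
    by split=> w; apply: linear_big => i k u v;
      rewrite mulPl ?lL' ?scalePl ?scalePr.
  apply: eq_bigr => u _ /=; rewrite /F.
  under eq_bigr => v _.
    rewrite (@sw_antipode _ A A (fun x y =>
      (l (u.2 * v.2 * y) : K) *: (u.1 * v.1 * x))); last first.
      by split=> w k y y'; rewrite mulPr ?lL' ?scalePl ?scalePr.
    over.
  rewrite exchange_big /=; apply: eq_bigr => w _.
  have /(congr1 (fun t => u.1 * t * S w.2)) :=
    invariants_sandwich u.2 (S w.1) bI lL.
  rewrite mulr_sumr mulr_suml -scalerAr -scalerAl => <-.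
  by apply: eq_bigr => v _; rewrite -scalerAr -scalerAl.
rewrite sw_assoc; last first.
  split=> [y z|x z|x y]; rewrite /F.
  - by apply: linear_big => w; lin.
  - by apply: linear_big => w k u v; rewrite mulPl lL' scalePl.
  - apply: (sw_linear (fun w1 w2 => (l (y * S w1) : K) *: (x * b * S w2))).
    split=> w k u v; rewrite /= linearP mulPr ?lL' ?scalePl//.
    by rewrite scalePr.
apply: eq_bigr => p _; rewrite /F.
rewrite -(sw_assoc (fun y z w => (l (y * S z) : K) *: (p.1 * b * S w)));
  last first.
  split=> x y k u v.
  - by rewrite mulPl lL' scalePl.
  - by rewrite linearP mulPr lL' scalePl.
  - by rewrite linearP mulPr scalePr.
under eq_bigr => q _.
  rewrite (sw_Sr (fun t => (l t : K) *: (p.1 * b * S q.2))); last first.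
    by move=> k u v; rewrite lL' scalePl.
  over.
by rewrite (sw_epsl (fun t => (l 1 : K) *: (p.1 * b * S t))); last by lin.
Qed.

Let skew_expand (a b c ex eb ez k1b k1z k2x k2b : K) :
  a * b * c * ((ex * k1b + k2x * eb) * k1z + k2x * k2b * ez) =
  a * k2x * (b * eb) * (c * k1z) + a * ex * (b * k1b) * (c * k1z) +
  a * k2x * (b * k2b) * (c * ez).
Proof. by ring. Qed.

Let drop_zero (a b c d e f s t u v : K) : s = v -> t = 0 -> u = 0 ->
  a * s * b + c * t * d + e * u * f = a * v * b.
Proof. by move=> -> -> ->; rewrite !mulr0 !mul0r !addr0. Qed.

(** Expanding Δ(E) over three factors gives three terms. In the two that apply
    k1 or k2 to b_(2), the middle factor is the value at b of a product of two
    elements of L, which is zero as ε(b) = 0; the term with E on b_(2)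
    remains. *)
Lemma conv_skew_sandwich l n (l1 l2 l3 : 'I_n -> A -> K^o) (E k1 k2 : A -> K^o)
    b x z : linear E -> grouplike k1 -> grouplike k2 -> k1 \in L -> k2 \in L ->
  (forall a a', E (a * a') = E a * k1 a' + k2 a * E a') ->
  l \in L -> (forall i, [/\ l1 i \in L, l2 i \in L & l3 i \in L]) ->
  coprod3 l l1 l2 l3 -> invariants L b -> eps b = 0 ->
  conv l E (x * b * z) =
  \sum_i conv (l1 i) k2 x * conv (l2 i) E b * conv (l3 i) k1 z.
Proof.
move=> EL [[k1L _] k11 k1M] [[k2L _] k21 k2M] k1in k2in ED l_in l123 lD bI b0.
have lL := hopf_linear l_in.
have [_ _ LM _ _] := hL.
have l1L i : linear (l1 i) by apply: hopf_linear; case: (l123 i).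
have l2L i : linear (l2 i) by apply: hopf_linear; case: (l123 i).
have l3L i : linear (l3 i) by apply: hopf_linear; case: (l123 i).
have kill i (k : A -> K^o) : linear k -> k \in L ->
    \sum_(q <- sw b) l2 i q.1 * k q.2 = 0.
  move=> kL kin; rewrite -conv_sw// (invariants_eps bI) ?b0 ?mulr0//.
  by apply: LM => //; case: (l123 i).
rewrite conv_sw// (sw_mul (fun x y => l x * E y)); last exact: mul_bilinear.
rewrite (sw_mul (fun x y => \sum_(r <- sw z)
    l (x * r.1) * E (y * r.2))); last first.
  by split=> w; apply: linear_big => i k u v;
    rewrite mulPl ?lL ?EL ?mulK_linl ?mulK_linr.
transitivity (\sum_(p <- sw x) \sum_(r <- sw z) \sum_i \sum_(q <- sw b)
   ((l1 i p.1 * k2 p.2) * (l2 i q.1 * E q.2) * (l3 i r.1 * k1 r.2)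
    + (l1 i p.1 * E p.2) * (l2 i q.1 * k1 q.2) * (l3 i r.1 * k1 r.2)
    + (l1 i p.1 * k2 p.2) * (l2 i q.1 * k2 q.2) * (l3 i r.1 * E r.2))).
  apply: eq_bigr => p _; rewrite exchange_big; apply: eq_bigr => r _ /=.
  rewrite exchange_big; apply: eq_bigr => q _ /=.
  rewrite lD mulr_suml; apply: eq_bigr => i _.
  rewrite !ED k2M.
  exact: skew_expand.
transitivity (\sum_(p <- sw x) \sum_(r <- sw z) \sum_i
   ((l1 i p.1 * k2 p.2) * (conv (l2 i) E b) * (l3 i r.1 * k1 r.2))).
  apply: eq_bigr => p _; apply: eq_bigr => r _; apply: eq_bigr => i _.
  rewrite !big_split /= -!mulr_suml -!mulr_sumr.
  by apply: drop_zero; [rewrite conv_sw|exact: kill|exact: kill].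
under eq_bigr do rewrite exchange_big.
rewrite exchange_big; apply: eq_bigr => i _ /=.
rewrite [conv (l1 i) _ _]conv_sw// [conv (l3 i) _ _]conv_sw// !mulr_suml.
by apply: eq_bigr => p _; rewrite mulr_sumr.
Qed.

End Functionals.

(** * The coideal subalgebra and its relative Hopf modules *)

Section CoidealSubalgebra.
Variables (K : fieldType) (A : hopfAlg K) (B : subalgClosed A).
Local Notation Bt := (subalg_of B).
Local Notation val := (@subalg_val K A B).
Local Notation S := (hS A).

Lemma subalg_val_linear : linear val.
Proof. by move=> k u v; exact: (linearP (\val : Bt -> A)). Qed.

Lemma subalg_valM (b c : Bt) : val (b * c) = val b * val c.
Proof. exact: (rmorphM (\val : Bt -> A)). Qed.

Lemma subalg_val1 : val 1 = 1.
Proof. exact: (rmorph1 (\val : Bt -> A)). Qed.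

Lemma subalg_val_inj : injective val.
Proof. exact: (@val_inj _ _ Bt). Qed.

Lemma idfun_linear (V : lmodType K) : linear (@idfun V).
Proof. by []. Qed.

Lemma tmap_val_inj (V : lmodType K) : injective (tmap (@idfun V) val).
Proof.
apply: tmap_inj; [by []|exact: subalg_val_linear|by []|exact: subalg_val_inj].
Qed.

Hypothesis Bco : left_coideal B.

Lemma hdeltaB_val b : tmap idfun val (hdeltaB b) = hdelta A (val b).
Proof.
by have [t tE] := Bco b; rewrite /hdeltaB -tE preimage_ofK//; exact: tmap_val_inj.
Qed.

Lemma hdeltaB_linear : linear (@hdeltaB K A B).
Proof.
have vL := tmap_lin (idfun_linear (V := A)) subalg_val_linear.
move=> k u v; apply: tmap_val_inj; rewrite vL !hdeltaB_val subalg_val_linear.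
exact: linearP.
Qed.

Lemma hdeltaB1 : hdeltaB (1 : Bt) = 1 ⊗ 1.
Proof.
apply: tmap_val_inj; rewrite hdeltaB_val tmapE//.
by rewrite subalg_val1 hdelta1.
Qed.

Lemma tassoc_natural (U V W W' : lmodType K) (g : W -> W')
    (t : tensor (tensor U V) W) :
  linear g -> tassoc (tmap idfun g t) = tmap idfun (tmap idfun g) (tassoc t).
Proof.
move=> gL; have gL' := tmap_lin (idfun_linear (V := V)) gL.
have gL'' := tmap_lin (idfun_linear (V := U)) gL'.
have aL (X Y Z : lmodType K) : linear (@tassoc K X Y Z) by exact: linearP.
rewrite tmap_tens// {2}[t]tensE !(lin_sum _ _ (aL _ _ _)) (lin_sum _ _ gL'').
apply: eq_bigr => p _ /=; rewrite {1 2}[p.1]tensE.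
rewrite !(lin_sum _ _ (pure_linl _)) !(lin_sum _ _ (aL _ _ _)) (lin_sum _ _ gL'').
by apply: eq_bigr => q _; rewrite !tassocE tmapE// tmapE.
Qed.

Lemma hdeltaB_coassoc (b : Bt) :
  tassoc (tmap (hdelta A) idfun (hdeltaB b)) = tmap idfun (@hdeltaB K A B) (hdeltaB b).
Proof.
have vL := subalg_val_linear.
have vL' := tmap_lin (idfun_linear (V := A)) vL.
have DL := @hdeltaL K A; have DBL := hdeltaB_linear.
have I : injective (tmap (@idfun A) (tmap (@idfun A) val)).
  by apply: tmap_inj => //; exact: tmap_val_inj.
apply: I; rewrite -tassoc_natural// tmap_comp//.
transitivity (tassoc (tmap (hdelta A) idfun (hdelta A (val b)))).
  by rewrite -hdeltaB_val tmap_comp.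
rewrite hdelta_coassoc -hdeltaB_val !tmap_comp//.
by congr (tmap _ _ _); apply/funext => x /=; rewrite hdeltaB_val.
Qed.

Definition swB (b : Bt) := tens (hdeltaB b).

Lemma swB_val (P : lmodType K) (f : A -> A -> P) b : bilinear2 f ->
  \sum_(p <- swB b) f p.1 (val p.2) = \sum_(p <- sw (val b)) f p.1 p.2.
Proof.
move=> fB; rewrite -[RHS]tlift_tens// -hdeltaB_val tmap_tens//.
by rewrite tlift_sumE.
Qed.

Variables (L : submodClosed (A -> K^o)) (hL : hopf_subalgebra L).
Hypothesis hB : forall a : A, a \in B <-> invariants L a.

Lemma val_invariants (b : Bt) : invariants L (val b).
Proof. by apply/hB; case: b. Qed.

(** The adjoint action, landing in B by [ad_invariants]; the default value 0 is
    never taken. *)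
Definition adB (b : Bt) (a : A) : Bt := insubd 0 (ad (val b) a).

Lemma adB_val b a : val (adB b a) = ad (val b) a.
Proof.
by apply: (@insubdK _ _ Bt); apply/hB/ad_invariants => //; exact: val_invariants.
Qed.

Lemma adB_linear b : linear (adB b).
Proof.
move=> k u v; apply: subalg_val_inj.
by rewrite subalg_val_linear !adB_val ad_linear.
Qed.

(** ad(c_(1) x) c_(2) = c ad(x) for ad(x) = x_(1) b S(x_(2)), by cancelling
    S(c_(2)) c_(3). This is what makes the two actions on a relative Hopf module
    commute. *)
Lemma adB_mul b c x :
  \sum_(p <- swB c) adB b (p.1 * x) * p.2 = c * adB b x.
Proof.
apply: subalg_val_inj; rewrite (lin_sum _ _ subalg_val_linear) subalg_valM adB_val.
under eq_bigr do rewrite subalg_valM adB_val.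
rewrite (@swB_val A (fun y z => ad (val b) (y * x) * z)); last first.
  split=> [w|w] k u v /=; last by rewrite mulPr.
  by rewrite mulPl ad_linear mulPl.
rewrite adE mulr_sumr.
under eq_bigr => p _.
  rewrite adE (sw_mul (fun y z => y * val b * S z)); last exact: ad_bilinear.
  rewrite exchange_big mulr_suml /=.
  over.
rewrite exchange_big /=; apply: eq_bigr => v _.
under eq_bigr => p _.
  rewrite mulr_suml.
  under eq_bigr do rewrite antipodeM -!mulrA.
  over.
rewrite (sw_assoc (fun y z t => y * (v.1 * (val b * (S v.2 * (S z * t))))));
  last by split=> y z; lin.
under eq_bigr => p _.
  rewrite (sw_Sl (fun t => p.1 * (v.1 * (val b * (S v.2 * t))))); last by lin.
  over.
rewrite (sw_epsr (fun t => t * (v.1 * (val b * (S v.2 * 1))))); last by lin.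
by rewrite mulr1 !mulrA.
Qed.

Section RightAction.
Variable F : relHopf B.
Hypothesis actB : bilinear2 (@rh_act K A B F).

Lemma adact_bilinear b : bilinear2 (fun a (f : F) => rh_act (adB b a) f).
Proof.
by split=> [f|a] k u v /=; rewrite ?adB_linear ?(bilinear_eqs actB).
Qed.

(** f b = (f_(-2) b S(f_(-1))) f_(0), with the coefficient taken in B. Only
    bilinearity of the left action is assumed, so that the formula also applies
    to a tensor product over B. *)
Lemma rh_ractE (f : F) b :
  rh_ract f b = tlift (fun a g => rh_act (adB b a) g) (rh_coact f).
Proof.
have valI : injective (tmap val (@idfun F)).
  by apply: tmap_inj; [exact: subalg_val_linear|by []|exact: subalg_val_inj|by []].
have aL := adB_linear b.
rewrite /rh_ract -/(ad (val b)).
have -> : tmap (ad (val b)) idfun (rh_coact f) =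
          tmap val idfun (tmap (adB b) (@idfun F) (rh_coact f)).
  rewrite tmap_comp//.
  by congr (tmap _ _ _); apply/funext => a /=; rewrite adB_val.
rewrite preimage_ofK// tmap_tens// tlift_sumE// tlift_tens//.
exact: adact_bilinear.
Qed.

End RightAction.

Lemma rh_ract_act (F : relHopf B) (f : F) b c : mod0 F ->
  rh_ract (rh_act c f) b = rh_act c (rh_ract f b).
Proof.
move=> [[actB act1 actM] _ _ _ coM].
have aB := adact_bilinear actB.
have actL x : linear (rh_act (r := F) x) by exact: actB.2.
rewrite !rh_ractE// coM.
pose g x c' := tlift (fun y h => (x * y) ⊗ rh_act c' h) (rh_coact f).
have gE x c' : g x c' = \sum_(q <- tens (rh_coact f)) (x * q.1) ⊗ rh_act c' q.2.
  rewrite /g tlift_tens//; split=> [z|z] k u v /=.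
    by rewrite mulPr purePl.
  by rewrite (bilinear_eqs actB) purePr.
have gB : bilinear2 g.
  split=> [y a' x x'|x a' y y']; rewrite !gE scaler_sumr -big_split;
  by apply: eq_bigr => q _; rewrite /= ?(bilinear_eqs actB) ?mulPl ?purePl ?purePr.
rewrite -/g [tlift g _]tlift_tens// (lin_sum _ _ (tlift_linear (aB b))).
under eq_bigr do rewrite gE tlift_sumE//.
rewrite exchange_big tlift_tens// (lin_sum _ _ (actL c)).
apply: eq_bigr => q _ /=.
under eq_bigr do rewrite -actM.
rewrite -(lin_sum (f := fun x => rh_act x q.2)); last exact: actB.1.
by rewrite adB_mul actM.
Qed.

Section TensorProduct.
Variables (F G : relHopf B) (hF : mod0 F).

Lemma proj_linear (V : lmodType K) (R : V -> Prop) : linear (proj R).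
Proof. by move=> k u v; exact: linearP. Qed.

Lemma rh_pure_bilinear : bilinear2 (@rh_pure K A B F G).
Proof.
by split=> [g|f] k u v; rewrite /rh_pure /bpure ?purePl ?purePr; exact: proj_linear.
Qed.

Lemma rh_pure_balanced (f : F) b (g : G) :
  rh_pure (rh_ract f b) g = rh_pure f (rh_act b g).
Proof. by apply/proj_eq/span_gen; exists f, b, g. Qed.

Local Notation bl f :=
  (blift (ra := @rh_ract K A B F) (la := @rh_act K A B G) f).

Lemma blift_proj (P : lmodType K) (f : F -> G -> P) t : bilinear2 f ->
  (forall m b n, f (rh_ract m b) n = f m (rh_act b n)) ->
  bl f (proj _ t) = tlift f t.
Proof.
move=> fB fb; apply: qrepr_proj; first exact: tlift_linear.
move=> _ [m [b [n ->]]]; have [g gE] := linear_ex (tlift_linear fB).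
by rewrite gE linearB -gE /= !tliftE// fb subrr.
Qed.

Lemma blift_linear (P : lmodType K) (f : F -> G -> P) : bilinear2 f ->
  (forall m b n, f (rh_ract m b) n = f m (rh_act b n)) -> linear (bl f).
Proof.
move=> fB fb k x y; rewrite -[x]qreprK -[y]qreprK -linearP.
by rewrite !blift_proj// (tlift_linear fB).
Qed.

(** The left action on a tensor product over B is defined by lifting
    (f, g) |-> b f ⊗ g; it is balanced because the left and right actions on F
    commute. *)
Lemma rh_tensor_act_bilinear : bilinear2 (@rh_act K A B (rh_tensor F G)).
Proof.
have [[actB _ _] _ _ _ _] := hF; have aE := bilinear_eqs actB.
have pE := bilinear_eqs rh_pure_bilinear.
have fB b : bilinear2 (fun (f : F) (g : G) => rh_pure (rh_act b f) g).
  by split=> w k u v; rewrite /= ?aE pE.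
split=> [x|b]; last first.
  apply: blift_linear; first exact: fB.
  move=> m c n; rewrite -/(rh_pure _ _) -/(rh_pure (rh_act b m) (rh_act c n)).
  by rewrite -rh_pure_balanced rh_ract_act.
have actE b : rh_act b x =
    \sum_(p <- tens (qrepr x)) rh_pure (rh_act b p.1) p.2.
  exact: (tlift_tens _ (fB b)).
move=> k b c; rewrite !actE.
rewrite scaler_sumr -big_split/=; apply: eq_bigr => p _.
by rewrite aE pE.
Qed.

End TensorProduct.

End CoidealSubalgebra.

(** * The pairing of the tangent and cotangent spaces *)

Lemma sub_val_insubd (K : fieldType) (V : lmodType K) (U : submodClosed V) t :
  sub_val (insubd (0 : sub_of U) t) = if t \in U then t else 0.
Proof. by rewrite -[LHS]/(\val _) val_insubd. Qed.

Section Calculus.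
Variables (K : fieldType) (A : hopfAlg K) (B : subalgClosed A).
Local Notation Bt := (subalg_of B).
Local Notation val := (@subalg_val K A B).
Local Notation eps := (heps A).
Variable L : submodClosed (A -> K^o).
Variable T : submodClosed (Bt -> K^o).
Hypothesis hT : tangent_space L T.

Lemma epsBE (b : Bt) : epsB b = eps (val b). Proof. by []. Qed.

Lemma epsB_linear : linear (@epsB K A B).
Proof. by move=> k u v; rewrite !epsBE subalg_val_linear linearP. Qed.

Lemma epsB1 : epsB (1 : Bt) = 1.
Proof. by rewrite epsBE subalg_val1 heps1. Qed.

Lemma T_linear (X : sub_of T) : linear (\val X).
Proof. by case: hT => + _ _ _ => /(_ _ (valP X))[]. Qed.

Lemma aug_sub (b : Bt) : b - (epsB b : K) *: 1 \in @augB K A B.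
Proof.
have [g gE] := linear_ex epsB_linear.
rewrite inE gE linearB linearZ -gE /= epsB1.
by rewrite -[_ *: 1]/(epsB b * 1) mulr1 subrr.
Qed.

Lemma V1_class1 : V1_class T 1 = 0.
Proof.
rewrite /V1_class epsB1 scale1r subrr.
have -> : insubd 0 (0 : Bt) = 0 :> sub_of (@augB K A B).
  by apply: val_inj; rewrite insubdK ?rpred0.
by rewrite linear0.
Qed.

Lemma V1_class_surj v : exists2 b, epsB b = 0 & V1_class T b = v.
Proof.
have /eqP b0 : (\val (qrepr v)) \in @augB K A B := valP (qrepr v).
exists (\val (qrepr v)) => //; rewrite /V1_class b0 scale0r subr0.
by rewrite valKd qreprK.
Qed.

Lemma pairT_proj (X : sub_of T) x : pairT X (proj _ x) = (\val X) (\val x).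
Proof.
apply: (@qrepr_proj K _ K^o (@annT K A B T) (fun x => (\val X) (\val x))).
  by move=> k u v; rewrite linearP T_linear.
by move=> y; apply; exact: valP.
Qed.

Lemma pairT_linear (X : sub_of T) : linear (pairT X : V1 T -> K^o).
Proof.
move=> k u v; rewrite -[u]qreprK -[v]qreprK -linearP !pairT_proj.
by rewrite linearP T_linear.
Qed.

Lemma pairT_linearl v : linear (fun X : sub_of T => pairT X v : K^o).
Proof. by move=> k X Y; rewrite /pairT linearP. Qed.

Lemma pairT_class (X : sub_of T) b : (\val X) 1 = 0 ->
  pairT X (V1_class T b) = (\val X) b.
Proof.
move=> X1; rewrite pairT_proj insubdK ?aug_sub//.
have [g gE] := linear_ex (T_linear X).
by rewrite gE linearB linearZ -gE /= X1 scaler0 subr0.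
Qed.

Lemma pairT_bilinear (v w : V1 T) :
  bilinear2 (fun X Y : sub_of T => pairT X v * pairT Y w : K^o).
Proof. by apply: mul_bilinear; exact: pairT_linearl. Qed.

Lemma pairT_bilinearr (X Y : sub_of T) :
  bilinear2 (fun v w => pairT X v * pairT Y w : K^o).
Proof. by apply: mul_bilinear; exact: pairT_linear. Qed.

Lemma pairTTE s v w : pairTT s (v ⊗ w) =
  tlift (fun X Y : sub_of T => pairT X v * pairT Y w : K^o) s.
Proof.
rewrite /pairTT; congr (tlift _ s); apply/funext => X; apply/funext => Y.
by rewrite tliftE//; exact: pairT_bilinearr.
Qed.

Lemma pairTT_linear v w :
  linear (fun s : tensor (sub_of T) (sub_of T) => pairTT s (v ⊗ w)).
Proof.
move=> k s t; rewrite /= !pairTTE; exact/tlift_linear/pairT_bilinear.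
Qed.

Lemma pairTT_pure X Y v w :
  pairTT (X ⊗ Y : tensor (sub_of T) (sub_of T)) (v ⊗ w) =
  pairT X v * pairT Y w :> K.
Proof. by rewrite pairTTE tliftE//; exact: pairT_bilinear. Qed.

Lemma pairTT_sumr I (r : seq I) X Y (v w : I -> V1 T) :
  pairTT (X ⊗ Y : tensor (sub_of T) (sub_of T)) (\sum_(i <- r) v i ⊗ w i) =
  \sum_(i <- r) pairT X (v i) * pairT Y (w i) :> K.
Proof.
have fB (t : tensor (V1 T) (V1 T)) : bilinear2 (fun X Y : sub_of T =>
    tlift (fun v w => pairT X v * pairT Y w : K^o) t).
  have E X' Y' := tlift_tens t (pairT_bilinearr X' Y').
  split=> Z k U U'; rewrite !E scaler_sumr -big_split; apply: eq_bigr => p _ /=.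
    by rewrite (pairT_linearl p.1) mulK_linl.
  by rewrite (pairT_linearl p.2) mulK_linr.
by rewrite /pairTT tliftE// tlift_sumE//; exact: pairT_bilinearr.
Qed.

Variables (m : nat) (X : 'I_m -> sub_of T) (e : 'I_m -> V1 T).
Hypothesis hXe : dual_bases X e.

Lemma dual_basis_coord (Y : sub_of T) : Y = \sum_i (pairT Y (e i) : K) *: X i.
Proof.
have [bX _ Xe] := hXe; have [c [Yc _]] := bX Y.
rewrite {1}Yc; apply: eq_bigr => i _; congr (_ *: _).
have cE j : pairT (c j *: X j) (e i) = c j * (j == i)%:R.
  by rewrite (linZ _ _ (pairT_linearl (e i))) Xe.
rewrite Yc (lin_sum _ _ (pairT_linearl (e i))) (bigD1 i)//= big1 ?addr0.
  by rewrite cE eqxx mulr1.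
by move=> j ji; rewrite cE (negPf ji) mulr0.
Qed.

(** The coordinates of a tensor in the basis X_i ⊗ X_j are its pairings with the
    e_i ⊗ e_j. *)
Lemma pairTT_nondegenerate (s t : tensor (sub_of T) (sub_of T)) :
  (forall v w, pairTT s (v ⊗ w) = pairTT t (v ⊗ w)) -> s = t.
Proof.
move=> st.
have E (u : tensor (sub_of T) (sub_of T)) :
    u = \sum_i \sum_j (pairTT u (e i ⊗ e j) : K) *: (X i ⊗ X j).
  rewrite {1}[u]tensE.
  have Eu i j : pairTT u (e i ⊗ e j) =
      \sum_(p <- tens u) pairT p.1 (e i) * pairT p.2 (e j).
    rewrite {1}[u]tensE (lin_sum _ _ (pairTT_linear _ _)).
    by apply: eq_bigr => p _; rewrite pairTT_pure.
  under [RHS]eq_bigr => i _.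
    under eq_bigr => j _ do rewrite Eu scaler_suml.
    rewrite exchange_big /=.
    over.
  rewrite exchange_big /=; apply: eq_bigr => p _.
  rewrite {1}[p.1]dual_basis_coord {1}[p.2]dual_basis_coord.
  rewrite (lin_sum _ _ (pure_linl _)); apply: eq_bigr => i _.
  rewrite (lin_sum _ _ (pure_linr _)); apply: eq_bigr => j _.
  by rewrite (linZ _ _ (pure_linl _)) (linZ _ _ (pure_linr _)) scalerA.
rewrite [LHS]E [RHS]E; apply: eq_bigr => i _; apply: eq_bigr => j _.
by rewrite st.
Qed.

End Calculus.

(** * The bimodule map of a covariant connection *)

Section BimoduleMap.
Variables (K : fieldType) (A : hopfAlg K) (B : subalgClosed A).
Local Notation Bt := (subalg_of B).
Local Notation val := (@subalg_val K A B).
Variables (L : submodClosed (A -> K^o)) (hL : hopf_subalgebra L).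
Hypotheses (hB : forall a : A, a \in B <-> invariants L a) (Bco : left_coideal B).
Variables (T : submodClosed (Bt -> K^o)) (hT : tangent_space L T).
Variable lam : {linear V1 T -> tensor (piB B) (V1 T)}.
Hypothesis hOmega : mod0 (Omega lam).
Variables (m : nat) (X : 'I_m -> sub_of T) (e : 'I_m -> V1 T).
Hypothesis hXe : dual_bases X e.
Variable d : Bt -> Omega lam.
Hypothesis hd : differential X e d.

Let theta (c : Bt) : V1 T := \sum_i (\val (X i) c : K) *: e i.

Let theta_linear : linear theta.
Proof.
by apply: linear_big => i k u v; rewrite (T_linear hT) scalePl.
Qed.

Let sub_val_linear : linear (@sub_val _ _ (cotensor lam)).
Proof. by move=> k u v; exact: (linearP (\val : Omega lam -> tensor A (V1 T))). Qed.

Let sub_val_inj : injective (@sub_val _ _ (cotensor lam)).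
Proof. exact: (@val_inj _ _ (sub_of (cotensor lam))). Qed.

Lemma d_val b : sub_val (d b) = tmap idfun theta (hdeltaB b).
Proof. exact: hd. Qed.

Lemma d_linear : linear d.
Proof.
move=> k u v; apply: sub_val_inj; rewrite sub_val_linear !d_val.
by rewrite (hdeltaB_linear Bco) (tmap_lin (idfun_linear (V := A)) theta_linear).
Qed.

(** d is a comodule map: the coaction of dc is c_(1) ⊗ dc_(2). *)
Lemma rh_coact_d c : rh_coact (d c) = tmap idfun d (hdeltaB c).
Proof.
have dL := d_linear; have DL := @hdeltaL K A; have DBL := hdeltaB_linear Bco.
have iL V := @idfun_linear K V.
have tL := tmap_lin (iL A) theta_linear.
have I : injective (tmap (@idfun A) (@sub_val _ _ (cotensor lam))).
  by apply: tmap_inj.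
rewrite -[LHS]/(preimage_of (tmap idfun (@sub_val _ _ (cotensor lam)))
       (tassoc (tmap (hdelta A) idfun (sub_val (d c))))).
rewrite d_val.
have -> : tmap (hdelta A) idfun (tmap idfun theta (hdeltaB c)) =
    tmap idfun theta (tmap (hdelta A) (@idfun Bt) (hdeltaB c)).
  by rewrite !tmap_comp//; exact: iL.
rewrite tassoc_natural// (hdeltaB_coassoc Bco) tmap_comp//.
have -> : tmap idfun theta \o @hdeltaB K A B = @sub_val _ _ (cotensor lam) \o d.
  by apply/funext => b; rewrite /= d_val.
rewrite -[tmap _ _ _](@tmap_comp _ _ _ _ _ _ _ idfun d idfun)//.
exact: preimage_ofK.
Qed.

Let Phi_linear (F : relHopf B) : linear (@Phi_class K A B F).
Proof. exact: proj_linear. Qed.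

Lemma Phi_class_act (F : relHopf B) b (f : F) :
  epsB b = 0 -> Phi_class (rh_act b f) = 0.
Proof.
move=> b0; have -> : 0 = Phi_class (0 : F).
  by rewrite /Phi_class linear0.
apply/proj_eq; rewrite subr0; apply: span_gen; exists b, f; split=> //.
by rewrite inE b0.
Qed.

Variables (i1 : {linear Phi (Omega lam) -> V1 T})
  (i2 : {linear Phi (OmegaOmega lam)
                -> tensor (Phi (Omega lam)) (Phi (Omega lam))}).
Hypothesis hi : Phi_identification d i1 i2.

(** The identification sends the class of d1 to the class of 1 in V^1, which is
    zero. As ε ⊗ id annihilates B^+ times the calculus and maps d1 to the sum of
    the X_i(1) e_i, all X_i(1) vanish. *)
Lemma tangent_at1 (Y : sub_of T) : (\val Y) 1 = 0.
Proof.
have [i1bij _ i1d _] := hi.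
pose ev (a : A) (v : V1 T) := (heps A a : K) *: v.
have evB : bilinear2 ev by split=> w k u v; rewrite /ev ?linearP ?scalePl ?scalePr.
have evL := tlift_linear evB.
pose kappa (w : Omega lam) := tlift ev (sub_val w).
have kL : linear kappa by move=> k u v; rewrite /kappa sub_val_linear evL.
have k0 (w : Omega lam) : @BpF K A B (Omega lam) w -> kappa w = 0.
  move=> [b [f [+ ->]]]; rewrite inE => /eqP b0.
  have bL : linear (fun a => val b * a) by move=> k u v; rewrite mulPr.
  pose t := tmap (fun a => val b * a) idfun (sub_val f).
  have actE : sub_val (rh_act (r := Omega lam) b f) =
    if t \in cotensor lam then t else 0 by exact: sub_val_insubd.
  (* a value outside the cotensor product is replaced by 0, which ε ⊗ id kills *)
  rewrite /kappa actE; case: (t \in _); last first.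
    by have [g ->] := linear_ex evL; exact: linear0.
  rewrite /t (tmap_tens _ bL (idfun_linear (V := V1 T))) (tlift_sumE _ _ _ evB).
  by apply: big1 => p _; rewrite /ev hepsM -epsBE b0 mul0r scale0r.
have d1 : Phi_class (d 1) = 0.
  by apply: (bij_inj i1bij); rewrite i1d V1_class1 linear0.
have /span_kernel - /(_ _ kappa kL k0) kd : d 1 \in Defs.span (@BpF K A B (Omega lam)).
  rewrite -[d 1]subr0; apply/proj_eq; rewrite [LHS]d1.
  by rewrite linear0.
have th0 : theta 1 = 0.
  rewrite -kd /kappa d_val hdeltaB1// tmapE// tliftE// /ev heps1 scale1r.
  by [].
have X0 i : (\val (X i)) 1 = 0.
  have [_ be _] := hXe; have [c [_ cU]] := be 0.
  have E1 : c = fun i => (\val (X i)) 1 by apply: cU; rewrite -[LHS]th0.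
  have E2 : c = fun=> 0.
    by apply: cU; rewrite big1// => j _; rewrite scale0r.
  by move: E2; rewrite E1 => /(congr1 (fun f => f i)).
have atL : linear (fun Z : sub_of T => (\val Z) 1 : K^o).
  by move=> k u v; rewrite linearP.
rewrite [Y](dual_basis_coord hXe) (lin_sum _ _ atL) big1// => j _.
by rewrite (linZ _ _ atL) X0 scaler0.
Qed.

Variable nabla : {linear Omega lam -> OmegaOmega lam}.
Hypotheses (hnabla : connection d nabla) (hcov : left_covariant nabla).
Variable sigma : {linear OmegaOmega lam -> OmegaOmega lam}.
Hypothesis hsigma : bimodule_map d nabla sigma.
Variable sigmaV : {linear tensor (V1 T) (V1 T) -> tensor (V1 T) (V1 T)}.
Hypothesis hsigmaV : is_Phi_sigma i1 i2 sigma sigmaV.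

(** In σ(dc ⊗ db) = ∇((dc) b) - ∇(dc) b, write ad_b(a) = a_(1) b S(a_(2)). Since
    (dc) b = ad_b(c_(1)) dc_(2), the Leibniz rule gives
    ∇((dc) b) = d(ad_b(c_(1))) ⊗ dc_(2) + ad_b(c_(1)) ∇(dc_(2)), and by
    covariance of ∇ the second sum is ∇(dc) b. So σ is the same for every
    covariant bimodule connection. *)
Lemma sigmaV_class c b :
  sigmaV (V1_class T c ⊗ V1_class T b) =
  \sum_(p <- swB c) V1_class T (adB b p.1) ⊗ V1_class T p.2.
Proof.
have [_ _ i1d i2E] := hi.
have [sact _ sE] := hsigma.
have [[actB _ _] _ _ _ _] := hOmega.
have actBB := rh_tensor_act_bilinear Bco hL hB (Omega lam) hOmega.
have dL := d_linear.
have i1L : linear i1 by exact: linearP.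
have i2L : linear i2 by exact: linearP.
have nL : linear nabla by exact: linearP.
have iiL := tmap_lin i1L i1L.
have PL := @Phi_linear (OmegaOmega lam).
have := hsigmaV (Phi_class (rh_pure (d c) (d b))).
rewrite i2E tmapE// !i1d => ->.
have -> : Phi_map sigma (Phi_class (rh_pure (d c) (d b))) =
    Phi_class (sigma (rh_pure (d c) (d b))).
  rewrite /Phi_map.
  apply: (@qrepr_proj K _ _ (@BpF K A B (OmegaOmega lam))
    (fun x => Phi_class (sigma x))).
    by move=> k u v; rewrite linearP PL.
  move=> _ [b' [f [b'0 ->]]]; rewrite sact Phi_class_act//.
  by apply/eqP; move: b'0; rewrite inE.
have adB_ := adact_bilinear hL hB.
have iL := idfun_linear (V := A).
have E1 : rh_ract (d c) b = \sum_(p <- swB c) rh_act (adB b p.1) (d p.2).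
  rewrite (rh_ractE hL hB actB) rh_coact_d (tmap_tens _ iL dL).
  exact: (tlift_sumE _ _ _ (adB_ _ actB b)).
have E2 : rh_ract (nabla (d c)) b =
    \sum_(p <- swB c) rh_act (adB b p.1) (nabla (d p.2)).
  rewrite (rh_ractE hL hB actBB) hcov rh_coact_d (tmap_tens _ iL dL).
  rewrite (lin_sum _ _ (tmap_lin iL nL)).
  under eq_bigr do rewrite (tmapE _ _ iL nL).
  exact: (tlift_sumE _ _ _ (adB_ _ actBB b)).
have E3 : sigma (rh_pure (d c) (d b)) =
    nabla (rh_ract (d c) b) - rh_ract (nabla (d c)) b.
  by rewrite sE addrC addrA addNr add0r.
rewrite E3 E1 (lin_sum _ _ nL) E2 -sumrB.
under eq_bigr do rewrite hnabla addrK.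
rewrite (lin_sum _ _ PL) (lin_sum _ _ i2L) (lin_sum _ _ iiL).
by apply: eq_bigr => p _; rewrite i2E tmapE// !i1d.
Qed.

End BimoduleMap.

(** * The dual of the bimodule map on skew-primitive tangent vectors *)

Section DualMap.
Variables (K : fieldType) (A : hopfAlg K) (B : subalgClosed A).
Local Notation Bt := (subalg_of B).

Lemma rho_conv (l E : A -> K^o) : left_coideal B -> linear l -> linear E ->
  rho (conv l E) = lact l (rho E : Bt -> K^o).
Proof.
move=> Bco lL EL; apply/funext => b.
have rL : linear (rho E : Bt -> K^o).
  by move=> k u v; rewrite /rho /= -EL -subalg_val_linear.
rewrite /lact tlift_tens; last exact: mul_bilinear.
by rewrite /rho /= conv_sw// -(swB_val Bco _ (mul_bilinear lL EL)).
Qed.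

End DualMap.

(** By non-degeneracy it suffices to pair with classes of c and b, where
    ε(b) = 0. The left side becomes (l E)(c_(1) b S(c_(2))) Y(c_(3)) by
    [sigmaV_class], and [conv_skew_sandwich] with x = c_(1) and z = S(c_(2))
    separates b from c. *)
Lemma dual_map_skew_primitive (K : fieldType) (A : hopfAlg K)
  (L : submodClosed (A -> K^o)) (hL : hopf_subalgebra L)
  (B : subalgClosed A) (hB : forall a : A, a \in B <-> invariants L a)
  (Bco : left_coideal B)
  (T : submodClosed (subalg_of B -> K^o)) (hT : tangent_space L T)
  (lam : {linear V1 T -> tensor (piB B) (V1 T)})
  (hOmega : mod0 (Omega lam))
  (m : nat) (X : 'I_m -> sub_of T) (e : 'I_m -> V1 T) (hXe : dual_bases X e)
  (d : subalg_of B -> Omega lam) (hd : differential X e d)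
  (nabla : {linear Omega lam -> OmegaOmega lam})
  (hnabla : connection d nabla) (hcov : left_covariant nabla)
  (sigma : {linear OmegaOmega lam -> OmegaOmega lam})
  (hsigma : bimodule_map d nabla sigma)
  (i1 : {linear Phi (Omega lam) -> V1 T})
  (i2 : {linear Phi (OmegaOmega lam)
                -> tensor (Phi (Omega lam)) (Phi (Omega lam))})
  (hi : Phi_identification d i1 i2)
  (sigmaV : {linear tensor (V1 T) (V1 T) -> tensor (V1 T) (V1 T)})
  (hsigmaV : is_Phi_sigma i1 i2 sigma sigmaV)
  (sigmaC : {linear tensor (sub_of T) (sub_of T)
                    -> tensor (sub_of T) (sub_of T)})
  (hsigmaC : is_dual_map sigmaV sigmaC)
  (E K1 K2 K1inv : A -> K^o)
  (hE : fdual E)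
  (hK1 : grouplike K1) (hK2 : grouplike K2) (hK1L : K1 \in L) (hK2L : K2 \in L)
  (hK1inv : conv_inverse K1 K1inv)
  (hDeltaE : forall a b : A, E (a * b) = E a * K1 b + K2 a * E b)
  (hET : (rho E : subalg_of B -> K^o) \in T)
  (l : A -> K^o) (hl : l \in L)
  (Y : sub_of T)
  (n : nat) (l1 l2 l3 : 'I_n -> A -> K^o)
  (hl123 : forall i, [/\ l1 i \in L, l2 i \in L & l3 i \in L])
  (hDeltal : coprod3 l l1 l2 l3) :
  sigmaC (in_T T (rho (conv l E)) ⊗ Y) =
  \sum_(i < n)
    in_T T (lact (conv (conv (conv (l1 i) K2) K1inv) (dualS (l3 i))) (\val Y))
    ⊗ in_T T (rho (conv (l2 i) E)).
Proof.
have [_ _ LM LS _] := hL.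
have [_ _ _ TL] := hT.
have EL : linear E by case: hE.
have Llin a : a \in L -> linear a by exact: hopf_linear.
have rhoT a : a \in L -> rho (conv a E) \in T.
  by move=> aL; rewrite rho_conv//; [exact: TL|exact: Llin].
have K1invE := grouplike_inverse hK1 hK1inv.
have K1invL : K1inv \in L by rewrite K1invE; exact: LS.
have [l1L l2L l3L] :
    [/\ forall i, l1 i \in L, forall i, l2 i \in L & forall i, l3 i \in L].
  by split=> i; case: (hl123 i).
have mL i : conv (conv (conv (l1 i) K2) K1inv) (dualS (l3 i)) \in L.
  by apply: (LM); [apply: (LM) => //; exact: LM|exact: LS].
have X1 := tangent_at1 Bco hT hXe hd hi.
have YL := T_linear hT Y.
have YT : \val Y \in T := valP Y.
have lE_ad a b : epsB b = 0 -> conv l E (@subalg_val K A B (adB b a)) =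
    \sum_i conv (conv (conv (l1 i) K2) K1inv) (dualS (l3 i)) a *
      conv (l2 i) E (@subalg_val K A B b).
  move=> b0; rewrite (adB_val hL hB) adE.
  rewrite (lin_sum _ _ (conv_linear (Llin _ hl) EL)).
  under eq_bigr do rewrite (conv_skew_sandwich hL _ _ EL hK1 hK2 hK1L hK2L
    hDeltaE hl hl123 hDeltal (val_invariants hB b) b0).
  rewrite exchange_big; apply: eq_bigr => i _ /=.
  have [l1l l3l] : linear (l1 i) /\ linear (l3 i) by split; exact: Llin.
  have [k1l k2l] : linear K1 /\ linear K2 by split; exact: Llin.
  have kil : linear K1inv by exact: Llin.
  have sl := dualS_linear l3l.
  set c := conv (l2 i) E _; have l12L := conv_linear l1l k2l.
  rewrite -convA// [in RHS]conv_sw//; last exact: conv_linear.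
  rewrite mulr_suml; apply: eq_bigr => q _.
  by rewrite K1invE -conv_dualS// mulrAC.
apply: (pairTT_nondegenerate hT hXe) => v w.
have [c _ <-] := V1_class_surj v; have [b b0 <-] := V1_class_surj w.
rewrite hsigmaC (sigmaV_class hL hB Bco hT hOmega hd hi hnabla hcov hsigma hsigmaV).
rewrite (pairTT_sumr hT) (lin_sum _ _ (pairTT_linear hT _ _)).
have inTE f : f \in T -> \val (in_T T f) = f by move=> fT; exact: insubdK.
pose c2 i : K := conv (l2 i) E (@subalg_val K A B b).
pose m_ i : A -> K := conv (conv (conv (l1 i) K2) K1inv) (dualS (l3 i)).
transitivity (\sum_i \sum_(p <- swB c) m_ i p.1 * (\val Y) p.2 * c2 i : K); last first.
  apply: eq_bigr => i _.
  rewrite (pairTT_pure hT) !(pairT_class hT)// !inTE ?rhoT ?TL ?YT//.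
  rewrite /lact tlift_tens; last by apply: mul_bilinear => //; exact: Llin.
  by rewrite mulr_suml.
rewrite exchange_big; apply: eq_bigr => p _ /=.
rewrite !(pairT_class hT)// inTE ?rhoT//.
rewrite -[rho (conv l E) _]/(conv l E (@subalg_val K A B _)) lE_ad// mulr_suml.
by apply: eq_bigr => i _; rewrite mulrAC.
Qed.

Theorem proposition4p8 (R : realType) (A : hopfAlg R[i])
  (L : submodClosed (A -> R[i]^o)) (hL : hopf_subalgebra L)
  (B : subalgClosed A) (hB : forall a : A, a \in B <-> invariants L a)
  (hBA : quantum_homogeneous B)
  (T : submodClosed (subalg_of B -> R[i]^o)) (hT : tangent_space L T)
  (lam : {linear V1 T -> tensor (piB B) (V1 T)}) (hlam : V1_coaction lam)
  (hOmega : mod0 (Omega lam))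
  (m : nat) (X : 'I_m -> sub_of T) (e : 'I_m -> V1 T) (hXe : dual_bases X e)
  (d : subalg_of B -> Omega lam) (hd : differential X e d)
  (nabla : {linear Omega lam -> OmegaOmega lam})
  (hnabla : connection d nabla) (hcov : left_covariant nabla)
  (sigma : {linear OmegaOmega lam -> OmegaOmega lam})
  (hsigma : bimodule_map d nabla sigma)
  (i1 : {linear Phi (Omega lam) -> V1 T})
  (i2 : {linear Phi (OmegaOmega lam)
                -> tensor (Phi (Omega lam)) (Phi (Omega lam))})
  (hi : Phi_identification d i1 i2)
  (sigmaV : {linear tensor (V1 T) (V1 T) -> tensor (V1 T) (V1 T)})
  (hsigmaV : is_Phi_sigma i1 i2 sigma sigmaV)
  (sigmaC : {linear tensor (sub_of T) (sub_of T)
                    -> tensor (sub_of T) (sub_of T)})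
  (hsigmaC : is_dual_map sigmaV sigmaC)
  (E K1 K2 K1inv : A -> R[i]^o)
  (hE : fdual E)
  (hK1 : grouplike K1) (hK2 : grouplike K2) (hK1L : K1 \in L) (hK2L : K2 \in L)
  (hK1inv : conv_inverse K1 K1inv)
  (hDeltaE : forall a b : A, E (a * b) = E a * K1 b + K2 a * E b)
  (hET : (rho E : subalg_of B -> R[i]^o) \in T)
  (l : A -> R[i]^o) (hl : l \in L)
  (Y : sub_of T) (W : A -> R[i]^o) (hW : fdual W) (hY : \val Y = rho W)
  (n : nat) (l1 l2 l3 : 'I_n -> A -> R[i]^o)
  (hl123 : forall i, [/\ l1 i \in L, l2 i \in L & l3 i \in L])
  (hDeltal : coprod3 l l1 l2 l3) :
  sigmaC (in_T T (rho (conv l E)) ⊗ Y) =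
  \sum_(i < n)
    in_T T (lact (conv (conv (conv (l1 i) K2) K1inv) (dualS (l3 i))) (\val Y))
    ⊗ in_T T (rho (conv (l2 i) E)).
Proof.
have [Bco _ _] := hBA.
exact: (@dual_map_skew_primitive _ A L hL B hB Bco T hT lam hOmega m X e hXe
  d hd nabla hnabla hcov sigma hsigma i1 i2 hi sigmaV hsigmaV sigmaC hsigmaC
  E K1 K2 K1inv hE hK1 hK2 hK1L hK2L hK1inv hDeltaE hET l hl Y
  n l1 l2 l3 hl123 hDeltal).
Qed.
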